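(* Let $\Omega\Subset\mathbb C^n$ be a bounded domain. Let $G$ be a continuous function on the cone $H_n^+$ of semi-positive hermitian $n\times n$ matrices which is degenerate elliptic ($H\le H'$ implies $G(H')\le G(H)$), let $g$ be a continuous function on $\Omega\times\mathbb R$ which is increasing in its second variable, and let $h$ be a continuous function on $\mathbb C^n$. Consider the equation $$G\big(u_{j\bar k}\big)+e^{g(z,u)+h(Du)}=0\quad\text{in }\Omega .$$ Let $u$ be an upper semicontinuous real-valued function on $\overline\Omega$ that is a viscosity subsolution in $\Omega$, and $v$ a lower semicontinuous real-valued function on $\overline\Omega$ that is a viscosity supersolution in $\Omega$. If $u\le v$ on $\partial\Omega$, then $u\le v$ in $\Omega$.
   Context: Identify $\mathbb C^n\simeq\mathbb R^{2n}$; for a real $C^2$ function $q$, $Dq$ is its gradient and $(q_{j\bar k})=\big(\partial^2q/\partial z_j\partial\bar z_k\big)$ its complex Hessian (the hermitian $(1,1)$-part of the real Hessian). $u$ is a viscosity subsolution if for every $x_0\in\Omega$ and every real $C^2$ function $q$ near $x_0$ with $q(x_0)=u(x_0)$ and $u-q$ having a local maximum at $x_0$, one has $(q_{j\bar k}(x_0))\ge0$ and $G(q_{j\bar k}(x_0))+e^{g(x_0,u(x_0))+h(Dq(x_0))}\le0$. $v$ is a viscosity supersolution if for every $x_0\in\Omega$ and every real $C^2$ function $q$ near $x_0$ with $q(x_0)=v(x_0)$ and $v-q$ having a local minimum at $x_0$ such that $(q_{j\bar k}(x_0))\ge0$, one has $G(q_{j\bar k}(x_0))+e^{g(x_0,v(x_0))+h(Dq(x_0))}\ge0$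 (no condition when the complex Hessian is not semi-positive). *)

(* Defs.v *)
(* mathcomp-analysis over R : realType, complex numbers R[i]
   from mathcomp-real-closed. C^n is identified with R^(2n) = 'rV[R]_(n + n):
   coordinate lshift n j is x_j = Re z_j and rshift n j is y_j = Im z_j. *)
From HB Require Import structures.
From mathcomp Require Import all_boot all_order all_algebra.
From mathcomp Require Import all_classical all_reals all_analysis.
From mathcomp Require Import complex.
Set Implicit Arguments. Unset Strict Implicit. Unset Printing Implicit Defensive.
Import Order.TTheory GRing.Theory Num.Theory.
Import numFieldNormedType.Exports.
Local Open Scope classical_set_scope.
Local Open Scope ring_scope.
Local Open Scope complex_scope.

Section Defs.
Variable R : realType.

Definition xcoord (n : nat) (j : 'I_n) : 'I_(n + n) := lshift n j.
Definition ycoord (n : nat) (j : 'I_n) : 'I_(n + n) := rshift n j.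

Definition evec (m : nat) (i : 'I_m) : 'rV[R]_m := delta_mx 0 i.

Definition partial (m : nat) (i : 'I_m) (f : 'rV[R]_m -> R) : 'rV[R]_m -> R :=
  fun x => derive f x (evec i).

Definition C2_near (m : nat) (f : 'rV[R]_m -> R) (x0 : 'rV[R]_m) : Prop :=
  exists2 r : R, 0 < r & forall y, ball x0 r y ->
    [/\ {for y, continuous f},
        forall i, derivable f y (evec i) /\ {for y, continuous (partial i f)}
      & forall i j, derivable (partial i f) y (evec j) /\
                    {for y, continuous (partial j (partial i f))}].

Definition grad (m : nat) (f : 'rV[R]_m -> R) (x : 'rV[R]_m) : 'rV[R]_m :=
  \row_i partial i f x.

(* complex Hessian (d^2 f / dz_j d zbar_k)(x), with d/dz = (d/dx - i d/dy)/2,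
   d/dzbar = (d/dx + i d/dy)/2 *)
Definition cHess (n : nat) (f : 'rV[R]_(n + n) -> R) (x : 'rV[R]_(n + n))
  : 'M[R[i]]_n :=
  \matrix_(j, k)
    ((partial (xcoord j) (partial (xcoord k) f) x
      + partial (ycoord j) (partial (ycoord k) f) x) / 4
     +i* ((partial (xcoord j) (partial (ycoord k) f) x
      - partial (ycoord j) (partial (xcoord k) f) x) / 4)).

Definition hermitian (n : nat) (H : 'M[R[i]]_n) : Prop :=
  forall j k, H k j = conjc (H j k).

Definition semipos (n : nat) (H : 'M[R[i]]_n) : Prop :=
  hermitian H /\
  forall xi : 'cV[R[i]]_n,
    0 <= \sum_j \sum_k conjc (xi j 0) * H j k * xi k 0.

Definition continuous_on_cone (n : nat) (G : 'M[R[i]]_n -> R) : Prop :=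
  forall H, semipos H -> forall e : R, 0 < e ->
    exists2 d : R, 0 < d & forall H', semipos H' ->
      (forall j k, `|H' j k - H j k| < d%:C) -> `|G H' - G H| < e.

Definition degenerate_elliptic (n : nat) (G : 'M[R[i]]_n -> R) : Prop :=
  forall H H', semipos H -> semipos H' -> semipos (H' - H) -> G H' <= G H.

Definition bounded_domain (m : nat) (O : set 'rV[R]_m) : Prop :=
  [/\ open O, connected O, O !=set0 & bounded_set O].

Definition usc_on (m : nat) (A : set 'rV[R]_m) (u : 'rV[R]_m -> R) : Prop :=
  forall x, A x -> forall e : R, 0 < e ->
    \forall y \near x, A y -> u y < u x + e.

Definition lsc_on (m : nat) (A : set 'rV[R]_m) (v : 'rV[R]_m -> R) : Prop :=
  forall x, A x -> forall e : R, 0 < e ->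
    \forall y \near x, A y -> v x - e < v y.

Definition visc_sub (n : nat) (O : set 'rV[R]_(n + n))
  (G : 'M[R[i]]_n -> R) (g : 'rV[R]_(n + n) -> R -> R)
  (h : 'rV[R]_(n + n) -> R) (u : 'rV[R]_(n + n) -> R) : Prop :=
  forall x0, O x0 -> forall q : 'rV[R]_(n + n) -> R,
    C2_near q x0 -> q x0 = u x0 ->
    (\forall y \near x0, u y - q y <= u x0 - q x0) ->
    semipos (cHess q x0) /\
    G (cHess q x0) + expR (g x0 (u x0) + h (grad q x0)) <= 0.

Definition visc_super (n : nat) (O : set 'rV[R]_(n + n))
  (G : 'M[R[i]]_n -> R) (g : 'rV[R]_(n + n) -> R -> R)
  (h : 'rV[R]_(n + n) -> R) (v : 'rV[R]_(n + n) -> R) : Prop :=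
  forall x0, O x0 -> forall q : 'rV[R]_(n + n) -> R,
    C2_near q x0 -> q x0 = v x0 ->
    (\forall y \near x0, v x0 - q x0 <= v y - q y) ->
    semipos (cHess q x0) ->
    0 <= G (cHess q x0) + expR (g x0 (v x0) + h (grad q x0)).

End Defs.

(* Main.v *)
(* The theorem on sums for semicontinuous functions has a direct proof that
   needs neither Alexandrov's theorem nor Jensen's lemma.

   Let [a] and [b] be the sup-convolutions of [u] and [- v], and
   [W (x, y) = a x + b y - N |x - y|^2], a semiconvex function on the doubled
   space.  Among the touching paraboloids of [W] from above (with quadratic part
   [A]) at points where [W] is almost maximal, take one that nearly minimizes
   the elliptic quantity [tr A + La * max (0, eta + max eigenvalue of A)].  For
   [La] large this forces [A <= - eta / 2].  A Hopf-type barrier shows that near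
   such a point [W] cannot fall below its touching paraboloid by more than a
   small multiple of [s] on a ball of squared radius [s]: otherwise a touching
   paraboloid with a smaller value would exist.  Since [a x + b y] has no mixed
   second difference, the tightness pins the mixed part of [A], and [A < 0] on
   the vectors [(xi, xi)] becomes the inequality [X <= Y] between the quadratic
   parts of exact test functions of [u] and [v].

   As [X <= Y] holds without error, semi-positivity of the complex Hessian
   passes from the test function of [u] to that of [v], and ellipticity of [G]
   leaves [g (x, u x) + h p <= g (y, v y) + h q] with [|x - y|] and [|p - q|]
   small and [u x - v y] near its positive maximum, against the strict
   monotonicity of [g]. *)
Require Import Defs.
From HB Require Import structures.
From mathcomp Require Import all_boot all_order all_algebra.
From mathcomp Require Import all_classical all_reals all_analysis.
From mathcomp Require Import complex.
From mathcomp Require Import ring lra.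
Set Implicit Arguments. Unset Strict Implicit. Unset Printing Implicit Defensive.
Import Order.TTheory GRing.Theory Num.Theory.
Import numFieldNormedType.Exports.
Local Open Scope classical_set_scope.
Local Open Scope ring_scope.

(** * Euclidean structure and quadratic forms *)

Section Euclidean.
Variable R : realType.
Implicit Types m : nat.

Definition dot {m} (x y : 'rV[R]_m) : R := \sum_i x 0 i * y 0 i.

(** [A] need not be symmetric; polarization and Hessians therefore involve [A + A^T]. *)
Definition qform {m} (A : 'M[R]_m) (x : 'rV[R]_m) : R := dot (x *m A) x.

Lemma dotC m (x y : 'rV[R]_m) : dot x y = dot y x.
Proof. by apply: eq_bigr => i _; rewrite mulrC. Qed.

Lemma dotDl m (x y z : 'rV[R]_m) : dot (x + y) z = dot x z + dot y z.
Proof. by rewrite -big_split; apply: eq_bigr => i _; rewrite mxE mulrDl. Qed.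

Lemma dotZl m (a : R) (x z : 'rV[R]_m) : dot (a *: x) z = a * dot x z.
Proof. by rewrite mulr_sumr; apply: eq_bigr => i _; rewrite mxE mulrA. Qed.

Lemma dotNl m (x z : 'rV[R]_m) : dot (- x) z = - dot x z.
Proof. by rewrite -scaleN1r dotZl mulN1r. Qed.

Lemma dotDr m (x y z : 'rV[R]_m) : dot x (y + z) = dot x y + dot x z.
Proof. by rewrite dotC dotDl !(dotC _ x). Qed.

Lemma dotZr m (a : R) (x z : 'rV[R]_m) : dot x (a *: z) = a * dot x z.
Proof. by rewrite dotC dotZl dotC. Qed.

Lemma dotNr m (x z : 'rV[R]_m) : dot x (- z) = - dot x z.
Proof. by rewrite dotC dotNl dotC. Qed.

Lemma dot0l m (x : 'rV[R]_m) : dot 0 x = 0.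
Proof. by rewrite -(scale0r 0) dotZl mul0r. Qed.

Lemma dot0r m (x : 'rV[R]_m) : dot x 0 = 0.
Proof. by rewrite dotC dot0l. Qed.

Definition dotE := (dotDl, dotDr, dotNl, dotNr, dotZl, dotZr, dot0l, dot0r).

Lemma dot_mx m (x y : 'rV[R]_m) : dot x y = (x *m y^T) 0 0.
Proof. by rewrite mxE; apply: eq_bigr => i _; rewrite mxE. Qed.

Lemma dot_mulmx m (A : 'M[R]_m) (x y : 'rV[R]_m) :
  dot (x *m A) y = dot x (y *m A^T).
Proof. by rewrite !dot_mx trmx_mul trmxK mulmxA. Qed.

Lemma sq_ge0 m (x : 'rV[R]_m) : 0 <= dot x x.
Proof. by apply: sumr_ge0 => i _; rewrite -expr2 sqr_ge0. Qed.

Lemma coord_sq m (x : 'rV[R]_m) i : x 0 i ^+ 2 <= dot x x.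
Proof.
rewrite /dot (bigD1 i) //= expr2 lerDl.
by apply: sumr_ge0 => j _; rewrite -expr2 sqr_ge0.
Qed.

Lemma sqD m (x y : 'rV[R]_m) :
  dot (x + y) (x + y) = dot x x + 2 * dot x y + dot y y.
Proof. by rewrite !dotE (dotC y x); ring. Qed.

Lemma sqD_le m (x y : 'rV[R]_m) :
  dot (x + y) (x + y) <= 2 * dot x x + 2 * dot y y.
Proof.
have := sq_ge0 (x - y); rewrite !dotE (dotC y x).
set a := dot x x; set b := dot y y; set c := dot x y; lra.
Qed.

Lemma sqDrev_le m (x y : 'rV[R]_m) :
  dot x x / 2 - dot y y <= dot (x - y) (x - y).
Proof.
have := sqD_le (x - y) y; rewrite subrK.
set a := dot x x; set b := dot y y; set c := dot (x - y) _; lra.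
Qed.

Lemma dot_delta m (x : 'rV[R]_m) i : dot x (evec R i) = x 0 i.
Proof.
rewrite /dot (bigD1 i) //= big1 ?addr0; first by rewrite mxE !eqxx mulr1.
by move=> j /negPf ji; rewrite mxE eqxx ji mulr0.
Qed.

Lemma sq_delta m (i : 'I_m) : dot (evec R i) (evec R i) = 1.
Proof. by rewrite dot_delta mxE !eqxx. Qed.

Lemma qformDl m (A B : 'M[R]_m) x : qform (A + B) x = qform A x + qform B x.
Proof. by rewrite /qform mulmxDr dotDl. Qed.

Lemma qformNl m (A : 'M[R]_m) x : qform (- A) x = - qform A x.
Proof. by rewrite /qform mulmxN dotNl. Qed.

Lemma qformZl m (a : R) (A : 'M[R]_m) x : qform (a *: A) x = a * qform A x.
Proof. by rewrite /qform -scalemxAr dotZl. Qed.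

Lemma qform_scalar m (a : R) (x : 'rV[R]_m) : qform a%:M x = a * dot x x.
Proof. by rewrite /qform mul_mx_scalar dotZl. Qed.

Lemma qform_sqr m (e x : 'rV[R]_m) : qform (e^T *m e) x = dot x e ^+ 2.
Proof.
rewrite /qform mulmxA [x *m _]mx11_scalar -dot_mx mul_scalar_mx dotZl.
by rewrite (dotC _ e) expr2.
Qed.

Lemma trace_sqr m (e : 'rV[R]_m) : \tr (e^T *m e) = dot e e.
Proof.
rewrite /mxtrace /dot; apply: eq_bigr => i _.
by rewrite mxE big_ord1 mxE.
Qed.

Lemma qformZ m (A : 'M[R]_m) a x : qform A (a *: x) = a ^+ 2 * qform A x.
Proof. by rewrite /qform -scalemxAl !dotE mulrA expr2. Qed.

Lemma qformN m (A : 'M[R]_m) x : qform A (- x) = qform A x.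
Proof. by rewrite -scaleN1r qformZ sqrrN expr1n mul1r. Qed.

Lemma qform0 m (A : 'M[R]_m) : qform A 0 = 0.
Proof. by rewrite /qform dot0r. Qed.

Lemma qformD m (A : 'M[R]_m) x y :
  qform A (x + y) = qform A x + dot (x *m (A + A^T)) y + qform A y.
Proof.
rewrite /qform mulmxDl !dotE mulmxDr dotDl (dot_mulmx A y x) (dotC y).
ring.
Qed.

Lemma trace_qform m (A : 'M[R]_m) : \tr A = \sum_i qform A (evec R i).
Proof.
by apply: eq_bigr => i _; rewrite /qform dot_delta -rowE mxE.
Qed.

Lemma mxtrace_ge_qform m (A : 'M[R]_m) C :
  (forall x, - C * dot x x <= qform A x) -> - C * m%:R <= \tr A.
Proof.
move=> AC; rewrite trace_qform mulr_natr -[X in _ *+ X]card_ord -sumr_const.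
by apply: ler_sum => i _; rewrite (le_trans _ (AC _)) // sq_delta mulr1.
Qed.

Lemma continuous_dot (T : topologicalType) m (f g : T -> 'rV[R]_m) (x : T) :
  {for x, continuous f} -> {for x, continuous g} ->
  {for x, continuous (fun y => dot (f y) (g y))}.
Proof.
move=> cf cg; apply: cvg_big => [|i _]; first exact: add_continuous.
apply: cvgM.
- exact: (cvg_comp _ _ cf (@coord_continuous _ _ _ 0 i _)).
- exact: (cvg_comp _ _ cg (@coord_continuous _ _ _ 0 i _)).
Qed.

Lemma continuous_qform (T : topologicalType) m A (f : T -> 'rV[R]_m) (x : T) :
  {for x, continuous f} -> {for x, continuous (fun y => qform A (f y))}.
Proof.
move=> cf; apply: cvg_big => [|i _]; first exact: add_continuous.
apply: cvgM; last exact: (cvg_comp _ _ cf (@coord_continuous _ _ _ 0 i _)).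
have E z : (z *m A) 0 i = dot z (row i A^T).
  by rewrite mxE; apply: eq_bigr => j _; rewrite !mxE.
under eq_fun do rewrite E; rewrite E.
by apply: (@continuous_dot _ _ f (fun=> row i A^T)); [exact: cf|exact: cst_continuous].
Qed.

Lemma continuous_sq m (y : 'rV[R]_m) :
  continuous (fun x : 'rV[R]_m => dot (x - y) (x - y)).
Proof.
move=> x; have cB : {for x, continuous (fun z : 'rV[R]_m => z - y)}.
  by apply: (@cvgB _ _ _ (nbhs x) _ id (fun=> y)); [exact: cvg_id|exact: cvg_cst].
exact: (continuous_dot cB cB).
Qed.

(** Neighbourhoods come from the sup norm; they are traded here for Euclidean balls given by a
    squared radius, which keeps the estimates polynomial. *)
Lemma near0_sqP m (A : 'rV[R]_m -> Prop) :
  (\forall d \near (0 : 'rV[R]_m), A d) <->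
  exists2 s, 0 < s & forall d, dot d d < s -> A d.
Proof.
split=> [/nbhs_ballP[e /= e0 eA]|[s s0 sA]].
  exists (e ^+ 2); first by rewrite exprn_gt0.
  move=> d de; apply: eA; split=> // i j.
  rewrite /ball /= mxE sub0r normrN (ord1 i) -ltr_sqr ?nnegrE ?normr_ge0 ?ltW//.
  by rewrite real_normK ?num_real// (le_lt_trans (coord_sq d j)).
have : \forall d \near (0 : 'rV[R]_m), dot (d - 0) (d - 0) < s.
  by have /cvgr_lt := @continuous_sq m 0 0; apply; rewrite subr0 dot0l.
by apply: filterS => d; rewrite subr0; exact: sA.
Qed.

End Euclidean.

(** * Superjets and the barrier *)

Section Superjets.
Variable R : realType.

(* The quadratic part [A] is not halved: the test paraboloid has Hessian
   [A + A^T]. *)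
Definition superjet {m} (w : 'rV[R]_m -> R) (z p : 'rV[R]_m) (A : 'M[R]_m) :=
  \forall d \near (0 : 'rV[R]_m), w (z + d) <= w z + dot p d + qform A d.

Lemma near_translate m (x : 'rV[R]_m) (P : 'rV[R]_m -> Prop) :
  (\forall z \near x, P z) -> \forall d \near (0 : 'rV[R]_m), P (x + d).
Proof.
have c : (fun d : 'rV[R]_m => x + d) @ (0 : 'rV[R]_m) --> x + 0.
  by apply: (@cvgD _ _ _ (nbhs (0 : 'rV[R]_m)) _ (fun=> x) id); [exact: cvg_cst|exact: cvg_id].
by rewrite addr0 in c; move=> xP; exact: c.
Qed.

Lemma near_dot m (e : 'rV[R]_m) (c : R) : 0 < c ->
  \forall d \near (0 : 'rV[R]_m), - c < dot e d.
Proof.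
have ce : {for (0 : 'rV[R]_m), continuous (fun d => dot e d)}.
  by apply: (@continuous_dot _ _ _ (fun=> e) id); [exact: cst_continuous|exact: cvg_id].
by move=> c0; move/cvgr_gt : ce; apply; rewrite dot0r oppr_lt0.
Qed.

Lemma compact_sq_ball m (y : 'rV[R]_m) (T : R) :
  compact [set z : 'rV[R]_m | dot (z - y) (z - y) <= T].
Proof.
pose seg i := [set` `[y 0 i - (T + 1), y 0 i + (T + 1)]%R].
apply: (@subclosed_compact _ _ [set z : 'rV[R]_m | forall i, seg i (z 0 i)]).
- have := @preimage_closed _ _ _ [set r : R | r <= T]
    (fun z _ => @continuous_sq R m y z).
  by apply; exact: closed_le.
- by apply: rV_compact => i; exact: segment_compact.
- move=> z /= zT i; rewrite /seg /= in_itv /= -ler_distlC distrC ler_norml.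
  have T0 : 0 <= T := le_trans (sq_ge0 _) zT.
  have := le_trans (coord_sq (z - y) i) zT; rewrite !mxE => zi.
  by apply/andP; split; nra.
Qed.

(** Taylor expansion of the barrier at offset [e] from its centre, with [t] standing for [|e|^2]:
    the slack [nu] absorbs the cubic term, and the quartic term has the favourable sign. *)
Lemma barrier_expansion m (e d : 'rV[R]_m) (k t T nu : R) : 0 <= k ->
  - (nu / 4) <= dot e d ->
  k * (T - t) ^+ 2 - k * (T - (t + 2 * dot e d + dot d d)) ^+ 2 <=
  dot ((4 * k * (T - t)) *: e) d +
  qform ((k * (2 * (T - t) + nu))%:M - (4 * k) *: (e^T *m e)) d.
Proof.
move=> k0 ed; rewrite qformDl qformNl qformZl qform_scalar qform_sqr dotZl (dotC d e).
have := sq_ge0 d; set a := dot e d in ed *; set b := dot d d => b0.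
rewrite -subr_ge0 [X in 0 <= X](_ : _ = k * (b * (nu + 4 * a) + b ^+ 2)); last by ring.
by rewrite mulr_ge0// addr_ge0 ?sqr_ge0// mulr_ge0//; lra.
Qed.

(* The barrier is [- k (T - |z - y|^2)^2] with [T = (1 + b) s]: on the annulus
   [s <= |z - y|^2 <= T] its radial second derivative dominates, so it cannot
   touch [w] from above. *)
Lemma superjet_growth m (w : 'rV[R]_m -> R) (y : 'rV[R]_m) (s c b ga La : R) :
  continuous w -> 0 < s -> 0 < c -> 0 < b -> 0 <= La ->
  (m%:R + La) * b <= 2^-1 -> ga * (b ^+ 2 * s) < 2 * c ->
  (forall z, dot (z - y) (z - y) <= s -> w z <= - c) ->
  (forall z, dot (z - y) (z - y) <= (1 + b) * s -> w z <= 0) ->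
  (forall z p A t, dot (z - y) (z - y) < (1 + b) * s -> superjet w z p A ->
    0 <= t -> (forall d, qform A d <= t * dot d d) -> - ga <= \tr A + La * t) ->
  forall z, dot (z - y) (z - y) <= (1 + b / 2) * s -> w z <= - (c / 4).
Proof.
move=> cw s0 c0 b0 La0 Lab gac wc w0 wA z1 z1s.
pose rho (z : 'rV[R]_m) := dot (z - y) (z - y); pose T := (1 + b) * s.
(* [k] makes the penalty equal to [c] on the inner sphere, where [T - rho z = b * s]; on the outer
   sphere it vanishes. Hence [psi <= 0] on the boundary of the annulus. *)
pose k := c / (b * s) ^+ 2; pose psi (z : 'rV[R]_m) := w z + k * (T - rho z) ^+ 2.
have bs0 : 0 < b * s by rewrite mulr_gt0.
have k0 : 0 < k by rewrite divr_gt0// exprn_gt0.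
have kc : k * (b * s) ^+ 2 = c by rewrite /k divfK// gt_eqF// exprn_gt0.
have crho : continuous rho by exact: continuous_sq.
rewrite leNgt; apply/negP => wz1.
have sz1 : s < rho z1 by rewrite ltNge; apply/negP => /wc; lra.
have zT1 : rho z1 <= T by rewrite /rho /T; lra.
(* At least half the width of the annulus remains beyond [z1], so the penalty there is at least
   [c / 4] and outweighs [w z1]. *)
have psi1 : 0 < psi z1.
  have : k * (b * s / 2) ^+ 2 <= k * (T - rho z1) ^+ 2.
    by rewrite ler_pM2l// /T -/(rho z1) in z1s *; rewrite ler_sqr ?nnegrE; lra.
  by rewrite exprMn mulrA kc /psi; lra.
pose Ann := [set z : 'rV[R]_m | s <= rho z <= T].
have cAnn : compact Ann.
  apply: (@subclosed_compact _ Ann _ _ (@compact_sq_ball m y T)); last by move=> z /andP[].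
  rewrite [Ann](_ : _ = (rho @^-1` [set r | s <= r]) `&` (rho @^-1` [set r | r <= T])).
    by apply: closedI; apply: preimage_closed => [z _|];
      [exact: crho|exact: closed_ge|exact: crho|exact: closed_le].
  by apply/seteqP; split => z /= => [/andP|/andP].
have cpsi : continuous psi.
  move=> z; apply: (@cvgD _ _ _ (nbhs z) _ w); first exact: cw.
  have cT : {for z, continuous (fun z => T - rho z)}.
    by apply: (@cvgB _ _ _ (nbhs z) _ (fun=> T)); [exact: cvg_cst|exact: crho].
  apply: (@cvgM _ _ (nbhs z) _ (fun=> k)); first exact: cvg_cst.
  exact: (cvg_comp _ _ cT (@exprn_continuous R 2 _)).
have Ann0 : Ann !=set0 by exists z1; rewrite /Ann /= (ltW sz1).
have [x] := compact_EVT_max Ann0 cAnn (continuous_subspaceT cpsi).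
rewrite inE => /= /andP[sx xT] xmax.
have psix : 0 < psi x.
  by rewrite (lt_le_trans psi1)// xmax// inE /Ann /= (ltW sz1).
have {}sx : s < rho x.
  rewrite lt_neqAle sx andbT; apply/eqP => sx'.
  have := wc x; rewrite -/(rho x) -sx' lexx => /(_ isT).
  by move: psix; rewrite /psi -sx' /T [_ - s](_ : _ = b * s) ?kc; [lra|ring].
have {}xT : rho x < T.
  rewrite lt_neqAle xT andbT; apply/eqP => xT'.
  have := w0 x; rewrite -/(rho x) xT' lexx => /(_ isT).
  by move: psix; rewrite /psi xT' subrr expr0n mulr0; lra.
pose e := x - y; pose A := (k * (2 * (T - rho x) + b * s))%:M - (4 * k) *: (e^T *m e).
have jet : superjet w x ((4 * k * (T - rho x)) *: e) A.
  have near_s : \forall d \near (0 : 'rV[R]_m), s < rho (x + d).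
    by apply: (near_translate (P := fun z => s < rho z)); have /cvgr_gt := crho x; apply.
  have near_T : \forall d \near (0 : 'rV[R]_m), rho (x + d) < T.
    by apply: (near_translate (P := fun z => rho z < T)); have /cvgr_lt := crho x; apply.
  have near_e := @near_dot m e _ (divr_gt0 bs0 (ltr0Sn R 3)).
  apply: filterS3 near_s near_T near_e => d sd dT ed.
  have psid : psi (x + d) <= psi x.
    by apply: xmax; rewrite inE /Ann /= !ltW.
  have := barrier_expansion (rho x) T (ltW k0) (ltW ed).
  have -> : rho x + 2 * dot e d + dot d d = rho (x + d).
    by rewrite /rho [x + d - y]addrAC [RHS]sqD.
  by move: psid; rewrite /psi -/A; lra.
pose t := k * (2 * (T - rho x) + b * s).
have t0 : 0 <= t by rewrite mulr_ge0 ?ltW//; lra.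
have At d : qform A d <= t * dot d d.
  rewrite /A qformDl qformNl qformZl qform_scalar qform_sqr gerBl.
  by rewrite mulr_ge0 ?sqr_ge0//; lra.
(* The rank-one part of [A] contributes less than [- 4 * k * s] to the trace, while the rest
   together with [La * t] is at most [3 / 2 * k * s]; the total falls below [- 2 * k * s], hence
   below [- ga]. *)
have := wA x _ A t xT jet t0 At.
rewrite /A linearB /= mxtrace_scalar linearZ /= trace_sqr -/(rho x) -/t.
apply/negP; rewrite -ltNge -mulr_natl.
have : (m%:R + La) * t <= k * (s * (3 / 2)).
  rewrite mulrCA ler_pM2l//.
  have : (m%:R + La) * (2 * (T - rho x) + b * s) <= (m%:R + La) * (3 * (b * s)).
    by rewrite ler_wpM2l ?addr_ge0// /T; lra.
  have : (m%:R + La) * b * (3 * s) <= 2^-1 * (3 * s) by rewrite ler_pM2r//; lra.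
  by lra.
have : k * s < k * rho x by rewrite ltr_pM2l.
have : ga < 2 * (k * s).
  have -> : k * s = c / (b ^+ 2 * s).
    by rewrite /k; field; rewrite ?gt_eqF.
  by rewrite mulrA ltr_pdivlMr// mulr_gt0// exprn_gt0.
have : 0 < k * s by rewrite mulr_gt0.
lra.
Qed.

End Superjets.

(** * Tight touching paraboloids of semiconvex functions *)

Section Rigidity.
Variables (R : realType) (m : nat).
Implicit Types (w W : 'rV[R]_m -> R) (U : set 'rV[R]_m).

Definition semiconvex C w :=
  forall z, exists l, forall d, w z + dot l d - C * dot d d <= w (z + d).

Lemma exists_small_scale (d : 'rV[R]_m) (s t0 : R) : 0 < s -> 0 < t0 ->
  exists t, [/\ 0 < t, t <= t0 & dot (t *: d) (t *: d) < s].
Proof.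
move=> s0 t00; pose q := dot d d; have q0 : 0 <= q := sq_ge0 d.
pose t1 := s / (s + 1 + q); have sq0 : 0 < s + 1 + q by lra.
have t10 : 0 < t1 by rewrite divr_gt0.
have t1q : t1 * (s + 1 + q) = s by rewrite /t1 divfK ?gt_eqF.
pose t := Num.min t0 t1.
have t0' : 0 < t by rewrite lt_min t00.
have tt1 : t <= t1 by rewrite ge_min lexx orbT.
exists t; split => //; first by rewrite ge_min lexx.
rewrite dotZl dotZr -/q mulrA.
have : t * t * q <= t1 * t1 * q by rewrite ler_wpM2r// ler_pM// ltW.
have : t1 * t1 * q = t1 * (t1 * q) by rewrite mulrA.
have : 0 <= t1 * q by rewrite mulr_ge0// ltW.
nra.
Qed.

Lemma superjet_qform_ge C w z p A : semiconvex C w -> superjet w z p A ->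
  forall d, - C * dot d d <= qform A d.
Proof.
move=> wC /near0_sqP[s s0 wA] d; have [l lw] := wC z.
have [t [t0 _ ts]] := exists_small_scale d s0 ltr01.
have := lw (t *: d); have := lw (- (t *: d)); have := wA _ ts.
have := wA (- (t *: d)); rewrite !dotNl !dotNr opprK => /(_ ts).
rewrite qformN qformZ !(dotZl, dotZr) => h1 h2 h3 h4.
rewrite -subr_ge0 -(pmulr_rge0 _ (exprn_gt0 2 t0)).
rewrite (_ : _ * _ = t ^+ 2 * qform A d + C * (t * (t * dot d d))); last by ring.
lra.
Qed.

(** Along [- (t *: d)] a mismatch between [p] and the subgradient [l] is of order [t], but the
    paraboloids on either side leave room only of order [t ^+ 2]. *)
Lemma superjet_subgradient C w z p A : semiconvex C w -> superjet w z p A ->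
  forall d, w z + dot p d - C * dot d d <= w (z + d).
Proof.
move=> wC /near0_sqP[s s0 wA] d; have [l lw] := wC z.
apply: le_trans (lw d); rewrite lerD2r lerD2l leNgt; apply/negP => ld.
pose a := dot p d - dot l d; have a0 : 0 < a by rewrite subr_gt0.
pose q := `|C * dot d d + qform A d| + 1.
have q0 : 0 < q by rewrite ltr_wpDl.
have [t [t0 tq ts]] := exists_small_scale d s0 (divr_gt0 a0 q0).
have := lw (- (t *: d)); have := wA (- (t *: d)).
rewrite !dotNl !dotNr opprK => /(_ ts).
rewrite qformN qformZ !(dotZl, dotZr) => h1 h2.
have h3 : t * a <= t * (t * (C * dot d d + qform A d)).
  by rewrite /a mulrBr expr2 in h1 *; lra.
move: h3; rewrite ler_pM2l//; apply/negP; rewrite -ltNge.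
rewrite ler_pdivlMr// in tq; apply: lt_le_trans tq.
by rewrite ltr_pM2l// /q (le_lt_trans (ler_norm _))// ltrDl.
Qed.

(* Three-point convexity along the ray from [y] through [z]. *)
Lemma semiconvex_drop C w z0 y s e th : semiconvex C w -> 0 <= C -> 0 < s ->
  (forall z, dot (z - z0) (z - z0) < s -> w z <= 0) ->
  dot (y - z0) (y - z0) <= s / 16 -> w y < - (e * s) ->
  th <= 36^-1 -> 12 * C * th <= e ->
  forall z, dot (z - y) (z - y) <= th * s -> w z <= - (e / 2 * s).
Proof.
move=> wC C0 s0 w0 ys wy th36 the z zs; rewrite leNgt; apply/negP => wz.
have [l lw] := wC z; pose d := y - z; have zy : z + d = y by rewrite addrC subrK.
have ds : dot d d <= th * s by rewrite /d -opprB dotNl dotNr opprK.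
(* Weights 2 and 1 on [y] and [z - 2 *: d] cancel [l]: [w z] is at most [- 2 / 3 * e * s] plus
   [2 * C * th * s], and the latter is at most [e * s / 6]. *)
have := lw d; have := lw (- (2 *: d)); rewrite zy !dotNl !dotNr opprK.
rewrite !(dotZl, dotZr).
have : w (z + - (2 *: d)) <= 0.
  apply: w0; rewrite (_ : _ - z0 = (y - z0) - 3 *: d); last first.
    rewrite -zy -[3]/(1 + 2) scalerDl scale1r; apply/rowP => i; rewrite !mxE; ring.
  apply: le_lt_trans (sqD_le _ _) _; rewrite dotNl dotNr opprK dotZl dotZr.
  have : th * s <= 36^-1 * s by rewrite ler_pM2r.
  lra.
have : C * dot d d <= C * (th * s) by rewrite ler_wpM2l.
have : 12 * C * th * s <= e * s by rewrite ler_pM2r.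
lra.
Qed.

(** Each round multiplies the squared radius by [1 + b / 2] and divides the depth [c] by 4; after at
    most [k] rounds the ball contains [z0], where [w] vanishes. The bound on [ga * s * 4 ^+ k] keeps
    every round admissible. *)
Lemma superjet_growth_iter w z0 y s b ga La : continuous w -> 0 < s ->
  0 < b <= 1 -> 0 <= La -> (m%:R + La) * b <= 2^-1 -> 0 <= ga ->
  dot (z0 - y) (z0 - y) <= s / 16 -> w z0 = 0 ->
  (forall z, dot (z - z0) (z - z0) < s -> w z <= 0) ->
  (forall z p A t, dot (z - z0) (z - z0) < s -> superjet w z p A ->
    0 <= t -> (forall d, qform A d <= t * dot d d) -> - ga <= \tr A + La * t) ->
  forall k s1 c, 0 < s1 -> 0 < c -> s / 16 <= (1 + b / 2) ^+ k * s1 ->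
  ga * s * 4 ^+ k < 32 * c ->
  ~ (forall z, dot (z - y) (z - y) <= s1 -> w z <= - c).
Proof.
move=> cw s0 /andP[b0 b1] La0 Lab ga0 ys wz0 w0 wA.
elim=> [|k IH] s1 c s10 c0 sk gak wc.
  by move: (wc z0); rewrite expr0 mul1r in sk; rewrite wz0 (le_trans ys sk); lra.
have [s1s|s1s] := leP (s / 16) s1.
  by move: (wc z0); rewrite wz0 (le_trans ys s1s); lra.
have bs1 : b * s1 <= s1 by rewrite ger_pMl.
have inball z : dot (z - y) (z - y) <= (1 + b) * s1 -> dot (z - z0) (z - z0) < s.
  move=> zy; rewrite (_ : z - z0 = (z - y) - (z0 - y)); last first.
    by rewrite opprB addrA subrK.
  apply: le_lt_trans (sqD_le _ _) _; rewrite dotNl dotNr opprK; lra.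
have four1 : 1 <= 4 ^+ k.+1 :> R by rewrite exprn_ege1// ler1n.
have gas : ga * s < 32 * c.
  by apply: le_lt_trans gak; rewrite ler_peMr// mulr_ge0// ltW.
apply: (IH ((1 + b / 2) * s1) (c / 4)).
- by rewrite mulr_gt0//; lra.
- by rewrite divr_gt0.
- by rewrite mulrA -exprSr.
- by move: gak; rewrite exprS; lra.
apply: (superjet_growth cw s10 c0 b0 La0 Lab _ wc (ga := ga)).
- have : b ^+ 2 * s1 <= s / 16.
    by rewrite expr2 -mulrA (le_trans _ (ltW s1s))// (le_trans _ bs1)// ler_pM2l.
  move=> bs; have : ga * (b ^+ 2 * s1) <= ga * (s / 16) by rewrite ler_wpM2l.
  lra.
- by move=> z /inball; exact: w0.
- by move=> z p A t /ltW/inball; exact: wA.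
Qed.

Lemma expr1D_ge (b c : R) : 0 < b -> exists k, c <= (1 + b) ^+ k.
Proof.
move=> b0; have bern k : 1 + k%:R * b <= (1 + b) ^+ k.
  elim: k => [|k IH]; first by rewrite mul0r addr0 expr0.
  have b1 : 0 <= 1 + b by lra.
  rewrite exprS; apply: le_trans (ler_wpM2l b1 IH).
  have : 0 <= k%:R * b * b by rewrite !mulr_ge0// ltW.
  by rewrite -natr1; lra.
exists (Num.truncn (c / b)).+1; apply: le_trans (bern _).
have := truncnS_gt (c / b); rewrite ltr_pdivrMr//; lra.
Qed.

Section Tangent.
Variables (W : 'rV[R]_m -> R) (z0 p : 'rV[R]_m) (A : 'M[R]_m).

(** The touching paraboloid is subtracted so that a superjet of [w], added back to [A], becomes a
    competitor in the minimization for [W]. *)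
Let w z := W z - (W z0 + dot p (z - z0) + qform A (z - z0)).

Lemma sub_tangent_continuous : continuous W -> continuous w.
Proof.
move=> cW z; have cB : {for z, continuous (fun z : 'rV[R]_m => z - z0)}.
  by apply: (@cvgB _ _ _ (nbhs z) _ id (fun=> z0)); [exact: cvg_id|exact: cvg_cst].
apply: (@cvgB _ _ _ (nbhs z) _ W); first exact: cW.
apply: (@cvgD _ _ _ (nbhs z)).
  apply: (@cvgD _ _ _ (nbhs z) _ (fun=> W z0)); first exact: cvg_cst.
  exact: (continuous_dot (@cst_continuous _ _ p z) cB).
exact: (continuous_qform (A := A) cB).
Qed.

Lemma sub_tangent_superjet z q B : superjet w z q B ->
  superjet W z (p + (z - z0) *m (A + A^T) + q) (A + B).
Proof.
apply: filterS => d; rewrite /w [z + d - z0]addrAC (qformD A (z - z0) d).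
rewrite (dotDr p (z - z0) d) qformDl !dotDl.
lra.
Qed.

Lemma sub_tangent_semiconvex C : semiconvex C W ->
  (forall d, qform A d <= 0) -> semiconvex C w.
Proof.
move=> WC A0 z; have [l lW] := WC z.
exists (l - (p + (z - z0) *m (A + A^T))) => d; have := lW d; have := A0 d.
rewrite /w [z + d - z0]addrAC (qformD A (z - z0) d).
rewrite (dotDr p (z - z0) d) dotDl dotNl dotDl; lra.
Qed.

End Tangent.


(* [z0, A] nearly minimizes [tr A + La t] over the superjets with
   [A <= t - eta]; the penalty [La t] forces [t <= eta / 2] there. *)
Theorem superjet_rigidity W U C eta e zb pb :
  continuous W -> open U -> semiconvex C W -> 0 <= C -> 0 < eta -> 0 < e ->
  U zb -> superjet W zb pb (- eta)%:M ->
  exists z0 p A s, [/\ U z0, 0 < s,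
    forall d, dot d d < s -> W (z0 + d) <= W z0 + dot p d + qform A d,
    forall d, qform A d <= - (eta / 2) * dot d d &
    forall d, dot d d <= s / 16 -> W z0 + dot p d + qform A d - e * s <= W (z0 + d)].
Proof.
move=> cW oU WC C0 eta0 e0 Uzb jetb.
(* Chosen so that [La * (eta / 2) = C * m%:R + 1], which turns a value below 1 into
   [t <= eta / 2]. *)
pose La := 2 * (C * m%:R + 1) / eta.
have Cm0 : 0 <= C * m%:R by rewrite mulr_ge0.
have La0 : 0 < La by rewrite divr_gt0//; lra.
have LaE : La * eta = 2 * (C * m%:R + 1) by rewrite /La divfK ?gt_eqF.
pose b := (2 * (m%:R + La + 1))^-1; have mLa : 0 < m%:R + La by rewrite ltr_wpDl.
have b0 : 0 < b by rewrite invr_gt0; lra.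
have bE : 2 * (m%:R + La + 1) * b = 1 by rewrite /b mulfV// gt_eqF//; lra.
have mLab : 0 < (m%:R + La) * b by rewrite mulr_gt0.
pose th := Num.min 36^-1 (e / (12 * C + 1)).
have C12 : 0 < 12 * C + 1 by lra.
have th0 : 0 < th by rewrite lt_min invr_gt0 ltr0n divr_gt0.
have th36 : th <= 36^-1 by rewrite ge_min lexx.
have the : 12 * C * th <= e.
  have : th <= e / (12 * C + 1) by rewrite ge_min lexx orbT.
  by rewrite ler_pdivlMr//; lra.
(* [k] rounds enlarge the squared radius from [th * s] to [s / 16]; the tolerance [ga] is fixed
   afterwards so that [ga * 4 ^+ k <= e]. *)
have [k kth] := expr1D_ge ((16 * th)^-1) (divr_gt0 b0 (ltr0Sn R 1)).
pose ga := Num.min 1 (e / 4 ^+ k).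
have fourk : 0 < 4 ^+ k :> R by rewrite exprn_gt0.
have ga0 : 0 < ga by rewrite lt_min ltr01 divr_gt0.
have ga1 : ga <= 1 by rewrite ge_min lexx.
have gak : ga * 4 ^+ k <= e.
  by rewrite -ler_pdivlMr// ge_min lexx orbT.
pose V := [set r | exists z p A t, [/\ U z, superjet W z p A, 0 <= t,
  forall d, qform A d <= (t - eta) * dot d d & r = \tr A + La * t]].
have V0 : V (\tr ((- eta)%:M : 'M[R]_m) + La * 0).
  exists zb, pb, (- eta)%:M, 0; split => // d.
  by rewrite qform_scalar sub0r.
have Vlb : lbound V (- C * m%:R).
  move=> r [z [p [A [t [_ jet t0 _ ->]]]]].
  have : 0 <= La * t by rewrite mulr_ge0// ltW.
  suff : - C * m%:R <= \tr A by lra.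
  by apply: mxtrace_ge_qform => d; exact: superjet_qform_ge WC jet d.
have infV : has_inf V.
  split; last by exists (- C * m%:R); exact: Vlb.
  by exists (\tr ((- eta)%:M : 'M[R]_m) + La * 0); exact: V0.
have [r [z0 [p [A [t [Uz0 jet t0 At ->]]]]] rlt] := inf_adherent ga0 infV.
have Vinf x : V x -> inf V <= x by apply: ge_inf; exact: infV.2.
have inf0 : inf V <= 0.
  apply: le_trans (Vinf _ V0) _.
  by rewrite mxtrace_scalar mulr0 addr0 mulrn_wle0// oppr_le0 ltW.
have trA : - C * m%:R <= \tr A.
  by apply: mxtrace_ge_qform => d; exact: superjet_qform_ge WC jet d.
(* [inf V <= 0] puts the value at [z0] below [ga <= 1], and [\tr A] is at least [- C * m%:R]. *)
have teta : t <= eta / 2.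
  by rewrite -(ler_pM2l La0) mulrA LaE; lra.
have Aeta d : qform A d <= - (eta / 2) * dot d d.
  by apply: le_trans (At d) _; rewrite ler_wpM2r ?sq_ge0//; lra.
have A0 d : qform A d <= 0.
  apply: le_trans (Aeta d) _.
  by rewrite mulNr oppr_le0 mulr_ge0 ?sq_ge0// divr_ge0// ltW.
have nearU : \forall d \near (0 : 'rV[R]_m), U (z0 + d).
  by apply: (near_translate (P := U)); exact: open_nbhs_nbhs.
have [s s0 sW] : exists2 s, 0 < s & forall d, dot d d < s ->
    U (z0 + d) /\ W (z0 + d) <= W z0 + dot p d + qform A d.
  by apply/near0_sqP; apply: filterS2 nearU jet => d; split.
exists z0, p, A, s; split => // [d /sW[]//|d ds].
pose w z := W z - (W z0 + dot p (z - z0) + qform A (z - z0)).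
rewrite leNgt; apply/negP => Wd.
have cw : continuous w by exact: sub_tangent_continuous.
have wC : semiconvex C w by exact: sub_tangent_semiconvex.
have wz0 : w z0 = 0 by rewrite /w subrr dot0r qform0 !addr0 subrr.
have w0 z : dot (z - z0) (z - z0) < s -> w z <= 0.
  by move=> /sW[_]; rewrite /w addrC subrK subr_le0.
(* Such a superjet of [w] puts [\tr (A + B) + La * (t + u)] into [V], and no element of [V]
   undercuts the near-minimal value by [ga]. *)
have wA z q B u : dot (z - z0) (z - z0) < s -> superjet w z q B ->
    0 <= u -> (forall d, qform B d <= u * dot d d) -> - ga <= \tr B + La * u.
  move=> /sW[+ _]; rewrite addrC subrK => Uz jetz u0 Bu.
  have : V (\tr (A + B) + La * (t + u)).
    exists z, (p + (z - z0) *m (A + A^T) + q), (A + B), (t + u); split => //.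
    - exact: sub_tangent_superjet jetz.
    - exact: addr_ge0.
    - by move=> d'; rewrite qformDl; have := At d'; have := Bu d'; lra.
  by move=> /Vinf; rewrite mxtraceD; lra.
pose y := z0 + d.
have yd : y - z0 = d by rewrite /y addrAC subrr add0r.
have ys : dot (y - z0) (y - z0) <= s / 16 by rewrite yd.
have wy : w y < - (e * s) by rewrite /w yd /y; lra.
have wdrop := semiconvex_drop wC C0 s0 w0 ys wy th36 the.
apply: (superjet_growth_iter cw s0 _ (ltW La0) _ (ltW ga0) _ wz0 w0 wA _ _ _ _ wdrop
  (b := b) (k := k)).
- rewrite b0; nra.
- by lra.
- by rewrite -opprB dotNl dotNr opprK.
- by rewrite mulr_gt0.
- by rewrite mulr_gt0// divr_gt0.
- rewrite (_ : s / 16 = (16 * th)^-1 * (th * s)); last first.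
    by field; rewrite gt_eqF.
  by rewrite ler_pM2r// mulr_gt0.
- have : ga * 4 ^+ k * s <= e * s by rewrite ler_pM2r.
  by have := mulr_gt0 e0 s0; lra.
Qed.

(** By the subgradient inequality a step of [p / (4 * C)] raises [W] by a multiple of [|p|^2 / C];
    near-maximality caps this gain. *)
Lemma superjet_gradient_le W C z p A eta sg :
  semiconvex C W -> 0 < C -> superjet W z p A -> 0 <= eta <= 1 / 4 ->
  (forall z', W z' + eta * dot z' z' <= W z + eta * dot z z + sg) ->
  dot p p <= 2 * (4 * C * sg + eta * dot z z).
Proof.
move=> WC C0 jet /andP[eta0 eta4] Wmax; pose q := (4 * C)^-1.
have q0 : 0 < q by rewrite invr_gt0 mulr_gt0.
have qC : C * q = 1 / 4 by rewrite /q; field; rewrite gt_eqF.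
clearbody q.
have := superjet_subgradient WC jet (q *: p); have := Wmax (z + q *: p).
rewrite sqD !(dotZl, dotZr) => h1 h2.
have := mulr_ge0 eta0 (mulr_ge0 (ltW q0) (mulr_ge0 (ltW q0) (sq_ge0 p))) => h3.
have h4 := mulr_ge0 (mulr_ge0 eta0 (ltW q0)) (sq_ge0 (z + p)); rewrite sqD in h4.
have E : C * (q * (q * dot p p)) = 1 / 4 * (q * dot p p) by rewrite -qC; ring.
have h5 : eta * (q * dot p p) <= 1 / 4 * (q * dot p p).
  by rewrite ler_wpM2r// mulr_ge0 ?sq_ge0// ltW.
have Es : sg = q * (4 * C * sg).
  have -> : q * (4 * C * sg) = 4 * (C * q) * sg by ring.
  by rewrite qC; lra.
rewrite -(ler_pM2l q0); lra.
Qed.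

(** The decay of [W] lets [W z + eta * |z|^2] attain its maximum. There [W] has a superjet with
    matrix [(- eta)%:M], the strict concavity that [superjet_rigidity] starts from. *)
Lemma superjet_near_maximum W C B zz k : continuous W ->
  semiconvex C W -> 0 < C -> (forall z, W z <= B - dot z z / 2) -> 0 < k ->
  exists z p A s eta, [/\ W zz - k < W z, dot p p <= k, 0 < s & 0 < eta] /\ [/\
    forall d, dot d d < s -> W (z + d) <= W z + dot p d + qform A d,
    forall d, qform A d <= - (eta / 2) * dot d d &
    forall d, dot d d <= s / 16 ->
      W z + dot p d + qform A d - eta / 32 * s <= W (z + d)].
Proof.
move=> cW WC C0 WB k'0; pose k1 := Num.min 1 k.
have [k0 kle1 k1k] : [/\ 0 < k1, k1 <= 1 & k1 <= k].
  by rewrite lt_min ltr01 !ge_min !lexx orbT.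
clearbody k1; pose r := 4 * (B - W zz) + 4.
have Wzz : 0 <= B - W zz by have := WB zz; have := sq_ge0 zz; lra.
have r4 : 4 <= r by rewrite /r; lra.
(* Outside squared radius [r], [F] is more than 1 below [F zz]. With [eta * r = k1 / 8] and
   [sg * C <= k1 / 16], the gradient bound [2 * (4 * C * sg + eta * |z|^2)] is at most
   [3 / 4 * k1]. *)
pose eta := k1 / (8 * r); pose sg := k1 / (16 * (C + 1)).
have etar : eta * r = k1 / 8 by rewrite /eta; field; rewrite gt_eqF//; lra.
have sgC : sg * (C + 1) = k1 / 16 by rewrite /sg; field; rewrite gt_eqF//; lra.
have eta0 : 0 < eta by rewrite divr_gt0// mulr_gt0//; lra.
have sg0 : 0 < sg by rewrite divr_gt0// mulr_gt0//; lra.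
clearbody eta sg.
have sgC0 : 0 < sg * C by rewrite mulr_gt0.
have eta32 : eta <= 1 / 32.
  have : eta * 4 <= eta * r by rewrite ler_pM2l.
  lra.
pose F z := W z + eta * dot z z.
have cF : continuous F.
  move=> z; apply: (@cvgD _ _ _ (nbhs z) _ W); first exact: cW.
  apply: (@cvgM _ _ (nbhs z) _ (fun=> eta)); first exact: cvg_cst.
  exact: (continuous_dot (@cvg_id _ (nbhs z)) (@cvg_id _ (nbhs z))).
have Fzz : W zz <= F zz by rewrite lerDl mulr_ge0 ?sq_ge0// ltW.
have Ffar z : r < dot z z -> F z < F zz - 1.
  move=> rz; rewrite {1}/F; have := WB z.
  have : eta * dot z z <= 1 / 32 * dot z z by rewrite ler_wpM2r ?sq_ge0.
  by rewrite /r in rz; lra.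
have [zm zmr Fmax] : exists2 zm, dot zm zm <= r & forall z, F z <= F zm.
  have Br : [set z : 'rV[R]_m | dot (z - 0) (z - 0) <= r] zz.
    by rewrite /= subr0 leNgt; apply/negP => /Ffar; lra.
  have [zm] := compact_EVT_max (ex_intro _ _ Br) (@compact_sq_ball R _ 0 r)
    (continuous_subspaceT cF).
  rewrite inE /= subr0 => zmr zmax; exists zm => // z.
  have [zr|/Ffar] := leP (dot z z) r; first by apply: zmax; rewrite inE /= subr0.
  by have := zmax zz; rewrite inE => /(_ Br); lra.
pose U := [set z | F zm - sg < F z].
have oU : open U.
  have : open (F @^-1` [set c | F zm - sg < c]).
    by apply: open_comp; [move=> z _; exact: cF|exact: open_gt].
  exact.
have Uzm : U zm by rewrite /U /=; lra.
have jetm : superjet W zm (- (2 * eta) *: zm) (- eta)%:M.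
  apply: filterE => d; have := Fmax (zm + d).
  by rewrite /F sqD qform_scalar dotZl; lra.
have e0 : 0 < eta / 32 by rewrite divr_gt0.
have [z [p [A [s [Uz s0 Wup Aneg Wlo]]]]] :=
  superjet_rigidity cW oU WC (ltW C0) eta0 e0 Uzm jetm.
exists z, p, A, s, eta; split => //.
have zr : eta * dot z z <= k1 / 8.
  rewrite -etar ler_pM2l// leNgt; apply/negP => /Ffar.
  by have := Fmax zz; rewrite /U /= in Uz; lra.
have Fz : F zm - sg < F z by [].
split => //; first by have := Fmax zz; rewrite /F in Fz Fzz *; lra.
have jetz : superjet W z p A by apply/near0_sqP; exists s.
have eta4 : 0 <= eta <= 1 / 4 by apply/andP; split; lra.
have Wmax z' : W z' + eta * dot z' z' <= W z + eta * dot z z + sg.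
  by have := Fmax z'; rewrite /F in Fz *; lra.
by have := superjet_gradient_le WC C0 jetz eta4 Wmax; lra.
Qed.

End Rigidity.

(** * Semicontinuity and sup-convolution *)

Section SupConvolution.
Variable R : realType.

(** Compactness is used twice, on coverings by sublevel sets [f x < c]: with [c] going to infinity
    it bounds [f], and with [c] increasing to an unattained supremum it yields a smaller upper
    bound. *)
Lemma usc_max m (K : set 'rV[R]_m) f : compact K -> K !=set0 -> usc_on K f ->
  exists2 x, K x & forall y, K y -> f y <= f x.
Proof.
move=> /compact_near_coveringP/near_covering_withinP cK [x0 Kx0] uf.
have /filter_ex[c fc] : \forall c \near +oo%R, K `<=` [set x | f x < c].
  apply: (cK _ _ (fun c x => f x < c)) => x Kx.
  exists ([set y | K y -> f y < f x + 1], [set c | f x + 1 < c]) => /=.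
    by split; [exact: (uf x Kx 1 ltr01)|apply: nbhs_pinfty_gt; exact: num_real].
  by move=> [y c] /= [fy xc] Ky; exact: lt_trans (fy Ky) xc.
have supK : has_sup (f @` K).
  by split; [exists (f x0), x0|exists c => _ [x Kx <-]; exact/ltW/fc].
apply: contrapT => nomax.
have flt x : K x -> f x < sup (f @` K).
  move=> Kx; have le_sup y : K y -> f y <= sup (f @` K).
    by move=> Ky; apply: ub_le_sup; [exact: supK.2|exists y].
  rewrite lt_neqAle le_sup// andbT.
  apply/eqP => fx; apply: nomax; exists x => // y Ky; rewrite fx.
  exact: le_sup.
have /filter_ex[d [dK dsup]] : \forall d \near (sup (f @` K))^'-,
    K `<=` [set x | f x < d] /\ d < sup (f @` K).
  apply: filterI; last exact: nbhs_left_lt.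
  apply: (cK R (sup (f @` K))^'- (fun c x => f x < c)) => x Kx.
  pose e := (sup (f @` K) - f x) / 2; have fx := flt _ Kx.
  exists ([set y | K y -> f y < f x + e], [set c | f x + e < c]) => /=.
    split; first by apply: uf => //; rewrite /e; lra.
    by apply: nbhs_left_gt; rewrite /e; lra.
  by move=> [y c'] /= [fy xc] Ky; exact: lt_trans (fy Ky) xc.
suff : sup (f @` K) <= d by rewrite leNgt dsup.
by apply: ge_sup; [exact: supK.1|move=> _ [x Kx <-]; exact/ltW/dK].
Qed.

Lemma continuous_usc m (K : set 'rV[R]_m) f : continuous f -> usc_on K f.
Proof.
move=> cf x _ e e0; have /cvgr_lt := cf x => /(_ (f x + e)).
by rewrite ltrDl => /(_ e0); apply: filterS.
Qed.

Lemma uscD m (K : set 'rV[R]_m) f g : usc_on K f -> usc_on K g ->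
  usc_on K (fun x => f x + g x).
Proof.
move=> uf ug x Kx e e0; have e20 : 0 < e / 2 by rewrite divr_gt0.
apply: filterS2 (uf x Kx _ e20) (ug x Kx _ e20) => y fy gy Ky.
by have := fy Ky; have := gy Ky; lra.
Qed.

(** [am x] selects a point where the supremum is attained; test paraboloids of [a] at [x] will be
    carried over to [f] at [am x]. *)
Lemma sup_convolution m (K : set 'rV[R]_m) f N : compact K -> K !=set0 ->
  usc_on K f -> exists a am, forall x,
  [/\ K (am x), a x = f (am x) - N * dot (x - am x) (x - am x) &
      forall y, K y -> f y - N * dot (x - y) (x - y) <= a x].
Proof.
move=> cK K0 uf.
have ex x : exists y, K y /\ forall y', K y' ->
    f y' - N * dot (x - y') (x - y') <= f y - N * dot (x - y) (x - y).
  have [|y Ky ymax] := @usc_max _ K (fun y => f y - N * dot (x - y) (x - y)) cK K0.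
    apply: uscD uf _; apply: continuous_usc => y.
    apply: (@cvgN _ _ _ (nbhs y)); apply: (@cvgM _ _ (nbhs y) _ (fun=> N)).
      exact: cvg_cst.
    have cB : {for y, continuous (fun y : 'rV[R]_m => x - y)}.
      by apply: (@cvgB _ _ _ (nbhs y) _ (fun=> x) id); [exact: cvg_cst|exact: cvg_id].
    exact: (continuous_dot cB cB).
  by exists y.
have [am amP] := choice ex.
exists (fun x => f (am x) - N * dot (x - am x) (x - am x)), am => x.
by have [] := amP x.
Qed.

Lemma dot_ge_AMGM m (l d : 'rV[R]_m) t u : t * u = 1 -> 0 < t ->
  - (t * dot l l + u * dot d d) / 2 <= dot l d.
Proof.
move=> tu t0; have := mulr_ge0 (ltW t0) (sq_ge0 (l + u *: d)).
rewrite sqD !(dotZl, dotZr) => h.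
have E : t * (dot l l + 2 * (u * dot l d) + u * (u * dot d d)) =
   t * dot l l + (t * u) * (2 * dot l d) + (t * u) * (u * dot d d) by ring.
by rewrite E tu in h; lra.
Qed.

(** The subgradient inequality is applied forwards from [z] and backwards from [z + d]; the growth
    bound on [l] controls both slopes uniformly near [z]. *)
Lemma subgradient_continuous m (w : 'rV[R]_m -> R) C B l : 0 <= C -> 0 <= B ->
  (forall z d, w z + dot (l z) d - C * dot d d <= w (z + d)) ->
  (forall z, dot (l z) (l z) <= B * (1 + dot z z)) -> continuous w.
Proof.
move=> C0 B0 lw lB z; apply/(@cvgrPdist_lt R R^o _ (nbhs z)) => e e0.
pose Q := B * (3 + 2 * dot z z); have zz0 := sq_ge0 z.
have Q0 : 0 <= Q by rewrite mulr_ge0//; lra.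
pose t := e / (2 * (Q + 1)); pose u := t^-1.
have Q1 : 0 < 2 * (Q + 1) by lra.
have t0 : 0 < t by rewrite divr_gt0.
have u0 : 0 < u by rewrite invr_gt0.
have tu : t * u = 1 by rewrite mulfV// gt_eqF.
have tQ : t * (2 * (Q + 1)) = e by rewrite /t divfK// gt_eqF.
have uC : 0 < 1 + u + C by lra.
pose s := Num.min 1 (e / (4 * (1 + u + C))).
have s0 : 0 < s by rewrite lt_min ltr01 divr_gt0// mulr_gt0.
suff H d : dot d d < s -> `|w z - w (z + d)| < e.
  have : \forall y \near z, dot (y - z) (y - z) < s.
    have /cvgr_lt := @continuous_sq R m z z => /(_ s).
    by rewrite subrr dot0l; exact.
  by apply: filterS => y /H; rewrite (addrC z) subrK.
move=> ds; have d1 : dot d d < 1 by apply: lt_le_trans ds _; rewrite ge_min lexx.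
have ds' : dot d d * (4 * (1 + u + C)) < e.
  by rewrite -ltr_pdivlMr ?mulr_gt0//; apply: lt_le_trans ds _; rewrite ge_min lexx orbT.
have dd0 := sq_ge0 d; have udd : 0 <= u * dot d d by rewrite mulr_ge0// ltW.
have Cdd : 0 <= C * dot d d by rewrite mulr_ge0.
have lz : t * dot (l z) (l z) <= t * Q.
  rewrite ler_pM2l//; apply: le_trans (lB z) _.
  by rewrite ler_wpM2l//; lra.
have lzd : t * dot (- l (z + d)) (- l (z + d)) <= t * Q.
  rewrite ler_pM2l// dotNl dotNr opprK; apply: le_trans (lB _) _.
  by rewrite ler_wpM2l//; have := sqD_le z d; lra.
have h1 := dot_ge_AMGM (l z) d tu t0.
have h2 := dot_ge_AMGM (- l (z + d)) d tu t0.
have h3 := lw z d; have := lw (z + d) (- d); rewrite addrK dotNr dotNl dotNr opprK => h4.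
by rewrite (dotNl _ d) in h2; rewrite ltr_norml; apply/andP; split; lra.
Qed.

(** The tolerance [t] depends only on a bound for [x], so a gradient error can be fixed before the
    gradients themselves are found. *)
Lemma uniformly_close m (h : 'rV[R]_m -> R) (r e : R) : continuous h -> 0 < e ->
  exists2 t, 0 < t & forall x p q, dot x x <= r -> dot p p <= t -> dot q q <= t ->
  `|h (x + p) - h (x + q)| < e.
Proof.
move=> ch e0; have cK := @compact_sq_ball R m 0 r.
move/compact_near_coveringP/near_covering_withinP in cK.
pose P (t : R) x := forall p q, dot p p <= t -> dot q q <= t ->
  `|h (x + p) - h (x + q)| < e.
have near_t : \forall t \near (0 : R)^'+,
    ([set z : 'rV[R]_m | dot (z - 0) (z - 0) <= r] `<=` P t) /\ 0 < t.
  apply: filterI; last exact: nbhs_right_gt.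
  apply: (cK R (0 : R)^'+ P) => x _.
  have [s s0 sh] : exists2 s, 0 < s & forall d, dot d d < s -> `|h x - h (x + d)| < e / 2.
    apply/near0_sqP; apply: (near_translate (P := fun y => `|h x - h y| < e / 2)).
    by have /cvgrPdist_lt := ch x; apply; rewrite divr_gt0.
  have s4 : 0 < s / 4 by rewrite divr_gt0.
  exists ([set y | dot (y - x) (y - x) < s / 4], [set t | t < s / 4]) => /=.
    split; last exact: nbhs_right_lt.
    have /cvgr_lt := @continuous_sq R m x x => /(_ (s / 4)).
    by rewrite subrr dot0l; exact.
  move=> [y t] /= [yx ts] _ p q pt qt.
  have close d : dot d d <= t -> `|h x - h (y + d)| < e / 2.
    move=> dt; rewrite (_ : y + d = x + (y - x + d)); last by rewrite addrA addrCA subrr addr0.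
    by apply: sh; have := sqD_le (y - x) d; lra.
  rewrite (_ : _ - _ = (h x - h (y + q)) - (h x - h (y + p))); last by ring.
  by apply: le_lt_trans (ler_normB _ _) _; have := close _ pt; have := close _ qt; lra.
have [t [tP t0]] := @filter_ex _ _ (at_right_proper_filter (0 : R)) _ near_t.
by exists t => // x p q xr; apply: tP; rewrite /= subr0.
Qed.

End SupConvolution.

(** * Theorem on sums *)

Section TheoremOnSums.
Variables (R : realType) (m : nat).
Implicit Types (x y : 'rV[R]_m) (z : 'rV[R]_(m + m)).

Lemma dot_row_mx x1 y1 x2 y2 :
  dot (row_mx x1 y1) (row_mx x2 y2) = dot x1 x2 + dot y1 y2 :> R.
Proof.
rewrite {1}/dot big_split_ord /=; congr (_ + _); apply: eq_bigr => i _.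
  by rewrite !row_mxEl.
by rewrite !row_mxEr.
Qed.

Lemma sq_split z : dot z z = dot (lsubmx z) (lsubmx z) + dot (rsubmx z) (rsubmx z).
Proof. by rewrite -{1 2}[z]hsubmxK dot_row_mx. Qed.

Lemma qform_row_mxl (A : 'M[R]_(m + m)) x : qform A (row_mx x 0) = qform (ulsubmx A) x.
Proof.
rewrite /qform -{1}[A]submxK mul_row_block !mul0mx !addr0 dot_row_mx dot0r addr0.
by [].
Qed.

Lemma qform_row_mxr (A : 'M[R]_(m + m)) x : qform A (row_mx 0 x) = qform (drsubmx A) x.
Proof.
rewrite /qform -{1}[A]submxK mul_row_block !mul0mx !add0r dot_row_mx dot0r add0r.
by [].
Qed.

Lemma lsubmxD_row z x y : lsubmx (z + row_mx x y) = lsubmx z + x.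
Proof. by rewrite linearD /= row_mxKl. Qed.

Lemma rsubmxD_row z x y : rsubmx (z + row_mx x y) = rsubmx z + y.
Proof. by rewrite linearD /= row_mxKr. Qed.

Lemma continuous_lsubmx : continuous (fun z => lsubmx z).
Proof.
move=> z /= U /nbhs_ballP[e e0 eU]; apply/nbhs_ballP; exists e => //= y [_ zy].
by apply: eU; split => // i j; rewrite !mxE; exact: zy.
Qed.

Lemma continuous_rsubmx : continuous (fun z => rsubmx z).
Proof.
move=> z /= U /nbhs_ballP[e e0 eU]; apply/nbhs_ballP; exists e => //= y [_ zy].
by apply: eU; split => // i j; rewrite !mxE; exact: zy.
Qed.

(** [am x] competes in the supremum at [x + d], which gives the subgradient; its growth is linear in
    [x] because [am x] stays in the bounded set [K]. *)
Lemma sup_convolution_continuous (K : set 'rV[R]_m) f N L a am : 0 <= N ->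
  (forall x, [/\ K (am x), a x = f (am x) - N * dot (x - am x) (x - am x) &
      forall y, K y -> f y - N * dot (x - y) (x - y) <= a x]) ->
  (forall x, K x -> dot x x <= L) ->
  (forall x d, a x + dot (- (2 * N) *: (x - am x)) d - N * dot d d <= a (x + d))
  /\ continuous a.
Proof.
move=> N0 aP KL.
have sub x d : a x + dot (- (2 * N) *: (x - am x)) d - N * dot d d <= a (x + d).
  have [Kx -> _] := aP x; have [_ _ ale] := aP (x + d); apply: le_trans (ale _ Kx).
  rewrite [x + d - am x]addrAC [in X in _ <= X]sqD dotZl; lra.
split => //; have L0 : 0 <= L by have [/KL + _ _] := aP 0; exact: le_trans (sq_ge0 _).
pose B := 4 * N ^+ 2 * (2 + 2 * L).
have N2 : 0 <= N ^+ 2 := sqr_ge0 N.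
apply: (@subgradient_continuous _ _ _ N B _ N0 _ sub) => [|x].
  by rewrite /B mulr_ge0//; lra.
rewrite !(dotZl, dotZr) !mulrA mulrNN.
have [/KL amL _ _] := aP x; have := sqD_le x (- am x); rewrite dotNl dotNr opprK => h.
rewrite (_ : 2 * N * (2 * N) = 4 * N ^+ 2); last by ring.
have N24 : 0 <= 4 * N ^+ 2 by lra.
rewrite /B -[_ * _ * (1 + _)]mulrA ler_wpM2l//; have := sq_ge0 x.
have : 0 <= L * dot x x by rewrite mulr_ge0// sq_ge0.
lra.
Qed.

(** [a] and [b] each see only one of the two increments and cancel; the coupling term alone
    remains. *)
Lemma mixed_second_difference (a b : 'rV[R]_m -> R) N z xi :
  let W z := a (lsubmx z) + b (rsubmx z)
    - N * dot (lsubmx z - rsubmx z) (lsubmx z - rsubmx z) in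
  W (z + row_mx xi xi) - W (z + row_mx xi 0) - W (z + row_mx 0 xi) + W z
  = 2 * N * dot xi xi.
Proof.
move=> W; rewrite /W !lsubmxD_row !rsubmxD_row !addr0.
set x := lsubmx z; set y := rsubmx z.
rewrite (_ : x + xi - (y + xi) = x - y); last by rewrite opprD addrACA subrr addr0.
rewrite (_ : x + xi - y = x - y + xi); last by rewrite addrAC.
rewrite (_ : x - (y + xi) = x - y + - xi); last by rewrite opprD addrA.
by rewrite !(sqD (x - y)) !dotNr dotNl; ring.
Qed.

Lemma doubled_continuous (a b : 'rV[R]_m -> R) N : continuous a -> continuous b ->
  continuous (fun z : 'rV[R]_(m + m) => a (lsubmx z) + b (rsubmx z)
    - N * dot (lsubmx z - rsubmx z) (lsubmx z - rsubmx z)).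
Proof.
move=> ca cb z; have cl := @continuous_lsubmx z; have cr := @continuous_rsubmx z.
have clr : {for z, continuous (fun z => lsubmx z - rsubmx z)}.
  by apply: (@cvgB _ _ _ (nbhs z)); [exact: cl|exact: cr].
apply: (@cvgB _ _ _ (nbhs z)).
  apply: (@cvgD _ _ _ (nbhs z)); first exact: (cvg_comp _ _ cl (@ca _)).
  exact: (cvg_comp _ _ cr (@cb _)).
apply: (@cvgM _ _ (nbhs z) _ (fun=> N)); first exact: cvg_cst.
exact: (continuous_dot clr clr).
Qed.

Lemma doubled_semiconvex (a b : 'rV[R]_m -> R) N la lb : 0 <= N ->
  (forall x d, a x + dot (la x) d - N * dot d d <= a (x + d)) ->
  (forall x d, b x + dot (lb x) d - N * dot d d <= b (x + d)) ->
  semiconvex (3 * N) (fun z : 'rV[R]_(m + m) => a (lsubmx z) + b (rsubmx z)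
    - N * dot (lsubmx z - rsubmx z) (lsubmx z - rsubmx z)).
Proof.
move=> N0 asub bsub z; set x := lsubmx z; set y := rsubmx z.
exists (row_mx (la x - (2 * N) *: (x - y)) (lb y + (2 * N) *: (x - y))) => d.
rewrite -[d]hsubmxK; set xi := lsubmx d; set zt := rsubmx d.
rewrite lsubmxD_row rsubmxD_row -/x -/y !dot_row_mx.
rewrite (_ : x + xi - (y + zt) = (x - y) + (xi - zt)); last by rewrite opprD addrACA.
have := asub x xi; have := bsub y zt; rewrite (sqD (x - y)).
rewrite (dotDl (la x)) (dotDl (lb y)).
rewrite !dotNl !(dotZl (2 * N)) (dotDr (x - y) xi) dotNr => h1 h2.
have : N * dot (xi - zt) (xi - zt) <= N * (2 * dot xi xi + 2 * dot zt zt).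
  rewrite ler_wpM2l//; apply: le_trans (sqD_le _ _) _.
  by rewrite dotNl dotNr opprK.
lra.
Qed.

(** For [|x|^2 = s / 16] the two lower bounds cost [eta / 16 * s] in the mixed second difference.
    The upper bound at [row_mx x x], of squared length [s / 8], wins back exactly this amount by the
    negativity of [A], so no error term survives. *)
Lemma separated_hessians (a b : 'rV[R]_m -> R) N z p (A : 'M[R]_(m + m)) s eta :
  let W z := a (lsubmx z) + b (rsubmx z)
    - N * dot (lsubmx z - rsubmx z) (lsubmx z - rsubmx z) in
  0 < s ->
  (forall d, dot d d < s -> W (z + d) <= W z + dot p d + qform A d) ->
  (forall d, qform A d <= - (eta / 2) * dot d d) ->
  (forall d, dot d d <= s / 16 ->
    W z + dot p d + qform A d - eta / 32 * s <= W (z + d)) ->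
  forall xi, qform (ulsubmx A) xi + qform (drsubmx A) xi + 2 * N * dot xi xi <= 0.
Proof.
move=> W s0 Wup Aneg Wlo xi; rewrite -qform_row_mxl -qform_row_mxr.
have [xi0|xi0] := eqVneq (dot xi xi) 0.
  have -> : xi = 0.
    apply/rowP => i; apply/eqP; rewrite !mxE -sqrf_eq0 eq_le sqr_ge0 andbT.
    by rewrite -xi0 coord_sq.
  by rewrite row_mx0 qform0 dot0l mulr0 !addr0.
have xi0' : 0 < dot xi xi by rewrite lt_neqAle eq_sym xi0 sq_ge0.
have mixed x : dot x x = s / 16 ->
    qform A (row_mx x 0) + qform A (row_mx 0 x) + 2 * N * dot x x <= 0.
  move=> xs.
  have E : W (z + row_mx x x) - W (z + row_mx x 0) - W (z + row_mx 0 x) + W z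
    = 2 * N * dot x x by exact: mixed_second_difference.
  set e1 : 'rV[R]_(m + m) := row_mx x 0; set e2 : 'rV[R]_(m + m) := row_mx 0 x.
  rewrite -/e1 -/e2 in E; clearbody W.
  have d1 : dot e1 e1 <= s / 16 by rewrite dot_row_mx dot0l addr0 xs.
  have d2 : dot e2 e2 <= s / 16 by rewrite dot_row_mx dot0l add0r xs.
  have d3 : dot (row_mx x x) (row_mx x x) = s / 8.
    by rewrite dot_row_mx xs; lra.
  have d3s : dot (row_mx x x) (row_mx x x) < s by rewrite d3; lra.
  have E12 : row_mx x x = e1 + e2 by rewrite add_row_mx addr0 add0r.
  have P3 : dot p (row_mx x x) = dot p e1 + dot p e2 by rewrite E12 dotDr.
  have := Wlo _ d1; have := Wlo _ d2; have := Wup _ d3s.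
  have := Aneg (row_mx x x); rewrite d3; lra.
(* The inequality is homogeneous of degree 2, so it suffices to test it at the length where the
   bounds balance. *)
pose c := Num.sqrt (s / 16 / dot xi xi).
have c2 : c ^+ 2 = s / 16 / dot xi xi by rewrite sqr_sqrtr// !divr_ge0 ?sq_ge0 ?ltW.
have c0 : 0 < c ^+ 2 by rewrite c2 !divr_gt0.
have := mixed (c *: xi); rewrite dotZl dotZr mulrA -expr2 {1}c2 divfK// => /(_ erefl).
have scl : row_mx (c *: xi) 0 = c *: row_mx xi 0 :> 'rV[R]_(m + m).
  by rewrite scale_row_mx scaler0.
have scr : row_mx 0 (c *: xi) = c *: row_mx 0 xi :> 'rV[R]_(m + m).
  by rewrite scale_row_mx scaler0.
by rewrite scl scr !(qformZ A c) mulrCA -!mulrDr pmulr_rle0.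
Qed.

Theorem theorem_on_sums (K : set 'rV[R]_m) (u v h : 'rV[R]_m -> R) x0 (rho : R) :
  compact K -> usc_on K u -> lsc_on K v -> continuous h -> K x0 -> 0 < rho ->
  exists x y p q X Y, [/\
    [/\ K x, K y, dot (x - y) (x - y) < rho & u x0 - v x0 - rho < u x - v y],
    `|h p - h q| < rho,
    \forall d \near (0 : 'rV[R]_m), K (x + d) -> u (x + d) <= u x + dot p d + qform X d,
    \forall d \near (0 : 'rV[R]_m), K (y + d) -> v y + dot q d + qform Y d <= v (y + d) &
    forall d, qform X d <= qform Y d].
Proof.
move=> cK uu lv ch Kx0 rho0; have K0 : K !=set0 by exists x0.
pose f x := - v x.
have uf : usc_on K f.
  move=> x Kx e e0; apply: filterS (lv x Kx e e0) => y vy Ky.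
  by rewrite /f; have := vy Ky; lra.
have [xu _ uB] := usc_max cK K0 uu.
have [xf _ fB] := usc_max cK K0 uf.
have [xL KxL KL0] : exists2 xL, K xL & forall x, K x -> dot x x <= dot xL xL.
  apply: (usc_max cK K0); apply: continuous_usc => z.
  exact: (continuous_dot (@cvg_id _ (nbhs z)) (@cvg_id _ (nbhs z))).
pose L := dot xL xL; have {}KL0 x : K x -> dot x x <= L := KL0 x.
have L0 : 0 <= L := sq_ge0 _; clearbody L.
pose M := u x0 - v x0; pose S := u xu + f xf - M.
have SE : u xu + f xf = S + M by rewrite /S subrK.
have S0 : 0 <= S by have := uB _ Kx0; have := fB _ Kx0; rewrite /S /M /f; lra.
clearbody S.
(* [N * rho] exceeds [3 * (S + 1)], while near the maximum the three penalties total at most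
   [S + 1]; this brings [am x] and [bm y] within squared distance [rho]. *)
pose N := 1 + 3 * (S + 2) / rho.
have Nrho : (N - 1) * rho = 3 * (S + 2).
  by rewrite /N addrAC subrr add0r divfK// gt_eqF.
have N1 : 1 <= N by rewrite lerDl divr_ge0 ?ltW//; lra.
clearbody N; have N0 : 0 < N by lra.
have [a [am aP]] := sup_convolution N cK K0 uu.
have [b [bm bP]] := sup_convolution N cK K0 uf.
have [asub ca] := sup_convolution_continuous (ltW N0) aP KL0.
have [bsub cb] := sup_convolution_continuous (ltW N0) bP KL0.
pose W (z : 'rV[R]_(m + m)) := a (lsubmx z) + b (rsubmx z)
  - N * dot (lsubmx z - rsubmx z) (lsubmx z - rsubmx z).
have cW : continuous W by exact: doubled_continuous.
have WC : semiconvex (3 * N) W by exact: doubled_semiconvex (ltW N0) asub bsub.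
have WB z : W z <= (S + M + 2 * L) - dot z z / 2.
  rewrite /W sq_split; set x := lsubmx z; set y := rsubmx z.
  (* As [N >= 1] and [L] bounds [K], the penalties alone produce the decay [- |z|^2 / 2]. *)
  have far c c' : K c' -> dot c c / 2 - L <= N * dot (c - c') (c - c').
    move=> Kc; have h1 := sqDrev_le c c'; have h2 := KL0 _ Kc.
    have := mulr_ge0 (_ : 0 <= N - 1) (sq_ge0 (c - c')).
    by rewrite subr_ge0 => /(_ N1); lra.
  have [Kax -> _] := aP x; have [Kby -> _] := bP y.
  have := far x _ Kax; have := far y _ Kby; have := uB _ Kax; have := fB _ Kby.
  by have := mulr_ge0 (ltW N0) (sq_ge0 (x - y)); lra.
pose zz := row_mx x0 x0.
have Wzz : M <= W zz.
  rewrite /W row_mxKl row_mxKr subrr dot0l mulr0 subr0.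
  have [_ _ /(_ _ Kx0)] := aP x0; have [_ _ /(_ _ Kx0)] := bP x0.
  by rewrite subrr dot0l mulr0 !subr0 /M /f; lra.
have [t t0 ht] := uniformly_close (16 * N ^+ 2 * (S + 2 * L + 1)) ch rho0.
pose k := Num.min 1 (Num.min rho t).
have [k0 k1 [krho kt]] : [/\ 0 < k, k <= 1 & k <= rho /\ k <= t].
  by rewrite !lt_min ltr01 rho0 !ge_min !lexx !orbT.
clearbody k.
have [z [p [A [s [eta [[Wz pk s0 eta0] [Wup Aneg Wlo]]]]]]] :=
  superjet_near_maximum zz cW WC (mulr_gt0 (ltr0Sn R 2) N0) WB k0.
have XY := separated_hessians s0 Wup Aneg Wlo.
set x := lsubmx z; set y := rsubmx z.
pose g1 := lsubmx p; pose g2 := rsubmx p.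
have zr : dot z z <= 2 * (S + 2 * L + 1) by have := WB z; lra.
have [Kx ax _] := aP x; have [Ky bx _] := bP y.
have WzE : W z = a x + b y - N * dot (x - y) (x - y) by [].
have [g1k g2k] : dot g1 g1 <= t /\ dot g2 g2 <= t.
  have := sq_ge0 g1; have := sq_ge0 g2; have := sq_split p; rewrite -/g1 -/g2.
  by clear - pk kt; split; lra.
(* [D] comes from differentiating the coupling term and is common to both gradients; only the small
   [g1] and [g2] separate them. *)
pose D := (2 * N) *: (x - y).
have Dr : dot D D <= 16 * N ^+ 2 * (S + 2 * L + 1).
  have -> : dot D D = 4 * N ^+ 2 * dot (x - y) (x - y).
    by rewrite dotZl dotZr; ring.
  have -> : 16 * N ^+ 2 * (S + 2 * L + 1) = 4 * N ^+ 2 * (4 * (S + 2 * L + 1)) by ring.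
  apply: ler_wpM2l; first by rewrite mulr_ge0// sqr_ge0.
  by have := sqD_le x (- y); have := sq_split z; rewrite -/x -/y dotNl dotNr opprK; lra.
(* The coupling adds [N%:M] to each diagonal block of [A], and the second block changes sign since
   [b] is the sup-convolution of [- v]. [XY] is then the required comparison. *)
exists (am x), (bm y), (D + g1), (D - g2), (ulsubmx A + N%:M), (- (drsubmx A + N%:M)).
split.
- have := sq_ge0 (x - y); have := sq_ge0 (x - am x); have := sq_ge0 (y - bm y).
  move=> n1 n2 n3; have m1 := mulr_ge0 (ltW N0) n1; have m2 := mulr_ge0 (ltW N0) n2.
  have m3 := mulr_ge0 (ltW N0) n3; split=> //; last by rewrite /f in bx; rewrite -/M; lra.
  have tri : dot (am x - bm y) (am x - bm y) <=
      3 * (dot (x - am x) (x - am x) + dot (y - bm y) (y - bm y) + dot (x - y) (x - y)).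
    set e1 := x - am x; set e2 := y - bm y; set e3 := x - y.
    rewrite (_ : am x - bm y = e2 + e3 - e1); last first.
      by apply/rowP => i; rewrite /e1 /e2 /e3 !mxE; ring.
    clearbody e1 e2 e3.
    have := sq_ge0 (e2 - e3); have := sq_ge0 (e2 + e1); have := sq_ge0 (e3 + e1).
    by rewrite !dotE ?(dotC e2 e1) ?(dotC e3 e2) ?(dotC e3 e1); lra.
  rewrite -(ltr_pM2l N0); have := ler_wpM2l (ltW N0) tri; have := uB _ Kx; have := fB _ Ky.
  by rewrite ax bx in WzE; lra.
- by apply: ht => //; rewrite dotNl dotNr opprK.
(* Shifting [x] and [am x] by the same [d] keeps the penalty, so the bound on [a (x + d)] becomes
   one on [u (am x + d)]. *)
- apply/near0_sqP; exists s => // d ds Kd.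
  have := Wup (row_mx d 0); rewrite dot_row_mx dot0l addr0 => /(_ ds).
  rewrite /W lsubmxD_row rsubmxD_row addr0 -/x -/y qform_row_mxl.
  have -> : dot p (row_mx d 0) = dot g1 d by rewrite -[p]hsubmxK dot_row_mx dot0r addr0.
  rewrite (addrAC x) (sqD (x - y) d).
  rewrite qformDl qform_scalar (dotDl D) (dotZl (2 * N)) => h1.
  have [_ _ /(_ _ Kd)] := aP (x + d); rewrite opprD addrACA subrr addr0. lra.
- apply/near0_sqP; exists s => // d ds Kd.
  have := Wup (row_mx 0 d); rewrite dot_row_mx dot0l add0r => /(_ ds).
  rewrite /W lsubmxD_row rsubmxD_row addr0 -/x -/y qform_row_mxr.
  have -> : dot p (row_mx 0 d) = dot g2 d by rewrite -[p]hsubmxK dot_row_mx dot0r add0r.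
  rewrite (opprD y) addrA (sqD (x - y) (- d)) !dotNr (dotNl d) opprK.
  rewrite qformNl qformDl qform_scalar (dotDl D) (dotNl g2) (dotZl (2 * N)) => h1.
  have [_ _ /(_ _ Kd)] := bP (y + d); rewrite opprD addrACA subrr addr0 /f.
  rewrite /f in bx; lra.
- move=> d; have := XY d; rewrite qformNl !qformDl !qform_scalar; lra.
Qed.

End TheoremOnSums.

(** * Quadratic test functions and the Levi form *)

Section QuadraticTestFunctions.
Variable R : realType.

Definition quadratic {m} (c : R) (x0 p : 'rV[R]_m) (A : 'M[R]_m) (x : 'rV[R]_m) : R :=
  c + dot p (x - x0) + qform A (x - x0).

Lemma is_derive_quadratic_growth m (f : 'rV[R]_m -> R) x v (l c : R) :
  (forall h : R, f (h *: v + x) - f x = h * l + h ^+ 2 * c) -> is_derive x v f l.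
Proof.
move=> fE.
have cvl : h^-1 *: ((f \o shift x) (h *: v) - f x) @[h --> 0^'] --> l.
  have cl : (fun h : R => l + h * c) @ (0 : R)^' --> l.
    rewrite [X in _ --> X](_ : l = l + 0 * c); last by ring.
    apply: cvg_within_filter.
    apply: (@cvgD _ _ _ (nbhs (0 : R)) _ (fun=> l)); first exact: cvg_cst.
    by apply: (@cvgM _ _ (nbhs (0 : R)) _ id (fun=> c)); [exact: cvg_id|exact: cvg_cst].
  apply: cvg_trans cl; apply: near_eq_cvg; near=> h.
  rewrite /= fE /GRing.scale /= expr2 -mulrA -mulrDr mulKf//.
  by near: h; exact: nbhs_dnbhs_neq.
by split; [apply/cvg_ex; exists l|exact: cvg_lim].
Unshelve. all: by end_near.
Qed.

Section Quadratic.
Variables (m : nat) (c : R) (x0 p : 'rV[R]_m) (A : 'M[R]_m).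
Let q := quadratic c x0 p A.
Let B := A + A^T.

Let is_derive_q x i : is_derive x (evec R i) q (p 0 i + dot (x - x0) (row i B)).
Proof.
apply: (@is_derive_quadratic_growth _ _ _ _ _ (qform A (evec R i))) => h.
rewrite /q /quadratic -[h *: _ + x - x0]addrA (addrC (h *: _)).
rewrite (qformD A (x - x0)) (dotDr p (x - x0)) qformZ !dotZr !dot_delta.
have -> : ((x - x0) *m (A + A^T)) 0 i = dot (x - x0) (row i B).
  by rewrite mxE; apply: eq_bigr => j _; rewrite !mxE [A j i + _]addrC.
ring.
Qed.

Lemma partial_quadratic i :
  partial i q = fun x => p 0 i + dot (x - x0) (row i B).
Proof.
apply/funext => x; exact: (@derive_val _ _ _ _ _ _ _ (is_derive_q x i)).
Qed.

Let is_derive_partial_q x i j : is_derive x (evec R j) (partial i q) (B i j).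
Proof.
apply: (@is_derive_quadratic_growth _ _ _ _ _ 0) => h.
rewrite partial_quadratic -[h *: _ + x - x0]addrA (dotDl (h *: _)) dotZl (dotC (evec R j)).
by rewrite dot_delta mxE; ring.
Qed.

Lemma partial2_quadratic i j : partial j (partial i q) = fun=> B i j.
Proof.
apply/funext => x; exact: (@derive_val _ _ _ _ _ _ _ (is_derive_partial_q x i j)).
Qed.

Lemma C2_near_quadratic x : C2_near q x.
Proof.
exists 1 => // y _; have cB : {for y, continuous (fun z : 'rV[R]_m => z - x0)}.
  by apply: (@cvgB _ _ _ (nbhs y) _ id (fun=> x0)); [exact: cvg_id|exact: cvg_cst].
split=> [|i|i j].
- apply: (@cvgD _ _ _ (nbhs y)).
    apply: (@cvgD _ _ _ (nbhs y) _ (fun=> c)); first exact: cvg_cst.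
    exact: (continuous_dot (@cst_continuous _ _ p y) cB).
  exact: (continuous_qform (A := A) cB).
- split; first exact: (@ex_derive _ _ _ _ _ _ _ (is_derive_q y i)).
  rewrite partial_quadratic.
  apply: (@cvgD _ _ _ (nbhs y) _ (fun=> p 0 i)); first exact: cvg_cst.
  exact: (continuous_dot cB (@cst_continuous _ _ (row i B) y)).
- split; first exact: (@ex_derive _ _ _ _ _ _ _ (is_derive_partial_q y i j)).
  by rewrite partial2_quadratic; exact: cst_continuous.
Qed.

Lemma grad_quadratic : grad q x0 = p.
Proof.
by apply/rowP => i; rewrite mxE partial_quadratic subrr dot0l addr0.
Qed.

Lemma quadratic_center : q x0 = c.
Proof. by rewrite /q /quadratic subrr dot0r qform0 !addr0. Qed.

End Quadratic.
End QuadraticTestFunctions.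

Section LeviForm.
Variables (R : realType) (n : nat).
Local Open Scope complex_scope.

(** The entries of [cHess] with second derivatives read off [E]; indices are reversed because
    [partial j (partial i q)] is the entry [(i, j)]. *)
Definition levi_mx (E : 'M[R]_(n + n)) : 'M[R[i]]_n :=
  \matrix_(j, k)
    ((E (xcoord k) (xcoord j) + E (ycoord k) (ycoord j)) / 4
     +i* ((E (ycoord k) (xcoord j) - E (xcoord k) (ycoord j)) / 4)).

Lemma cHess_quadratic c x0 p (A : 'M[R]_(n + n)) :
  cHess (quadratic c x0 p A) x0 = levi_mx (A + A^T).
Proof.
have P2 i j : partial j (partial i (quadratic c x0 p A)) x0 = (A + A^T) i j.
  by rewrite partial2_quadratic.
by apply/matrixP => j k; rewrite [LHS]mxE [RHS]mxE !P2.
Qed.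

Lemma levi_mxB (E F : 'M[R]_(n + n)) : levi_mx (E - F) = levi_mx E - levi_mx F.
Proof.
apply/matrixP => j k; rewrite !mxE; apply/eqP; rewrite eq_complex /=.
by apply/andP; split; apply/eqP; ring.
Qed.

Lemma qform_sum m (E : 'M[R]_m) x :
  qform E x = \sum_j \sum_k E j k * (x 0 j * x 0 k).
Proof.
rewrite exchange_big /=; apply: eq_bigr => k _; rewrite mxE mulr_suml.
by apply: eq_bigr => j _; ring.
Qed.

Lemma qform_row_mx (E : 'M[R]_(n + n)) (s r : 'rV[R]_n) :
  qform E (row_mx s r) = \sum_j \sum_k
    (E (xcoord j) (xcoord k) * (s 0 j * s 0 k) +
     E (xcoord j) (ycoord k) * (s 0 j * r 0 k) +
     E (ycoord j) (xcoord k) * (r 0 j * s 0 k) +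
     E (ycoord j) (ycoord k) * (r 0 j * r 0 k)).
Proof.
rewrite qform_sum big_split_ord /= -big_split /=; apply: eq_bigr => j _.
rewrite !big_split_ord /= -!big_split /=; apply: eq_bigr => k _.
by rewrite !row_mxEl !row_mxEr /xcoord /ycoord; ring.
Qed.

Lemma semiposD (H K : 'M[R[i]]_n) : semipos H -> semipos K -> semipos (H + K).
Proof.
move=> [Hh H0] [Kh K0]; split=> [j k|xi]; first by rewrite !mxE Hh Kh rmorphD.
rewrite (_ : \sum_j _ = (\sum_j \sum_k conjc (xi j 0) * H j k * xi k 0) +
    \sum_j \sum_k conjc (xi j 0) * K j k * xi k 0); first exact: addr_ge0.
rewrite -big_split; apply: eq_bigr => j _; rewrite -big_split; apply: eq_bigr => k _.
by rewrite mxE mulrDr mulrDl.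
Qed.

(* The Levi form at [s + i t] is the real form averaged over the real vectors
   [(s, - t)] and [(t, s)]. *)
Lemma semipos_levi_mx (E : 'M[R]_(n + n)) : E^T = E ->
  (forall x, 0 <= qform E x) -> semipos (levi_mx E).
Proof.
move=> ET E0; have Es a b : E a b = E b a by rewrite -{1}ET mxE.
split=> [j k|xi].
  rewrite !mxE; apply/eqP; rewrite eq_complex /= !(Es _ (xcoord k)) !(Es _ (ycoord k)).
  by apply/andP; split; apply/eqP => //; ring.
have Esym j k := (Es (xcoord k) (xcoord j), Es (ycoord k) (ycoord j),
  Es (ycoord k) (xcoord j), Es (xcoord k) (ycoord j)).
pose s : 'rV[R]_n := \row_j complex.Re (xi j 0).
pose t : 'rV[R]_n := \row_j complex.Im (xi j 0).
have ReD (z w : R[i]) : complex.Re (z + w) = complex.Re z + complex.Re w.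
  by case: z w => ? ? [].
have ImD (z w : R[i]) : complex.Im (z + w) = complex.Im z + complex.Im w.
  by case: z w => ? ? [].
have -> : \sum_j \sum_k conjc (xi j 0) * levi_mx E j k * xi k 0 =
    ((qform E (row_mx s (- t)) + qform E (row_mx t s)) / 4)%:C.
  apply/eqP; rewrite eq_complex /=; apply/andP; split; apply/eqP.
    rewrite (big_morph _ ReD (erefl _)) !qform_row_mx -big_split mulr_suml.
    apply: eq_bigr => j _; rewrite (big_morph _ ReD (erefl _)) -big_split mulr_suml.
    apply: eq_bigr => k _; rewrite !mxE !(Esym j k).
    by case: (xi j 0) (xi k 0) => a b [a' b'] /=; field.
  (* The imaginary parts are antisymmetric in [j] and [k], so their sum is its own opposite. *)
  pose F j k := complex.Im (conjc (xi j 0) * levi_mx E j k * xi k 0).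
  have FN j k : F j k = - F k j.
    rewrite /F !mxE !(Esym j k).
    by case: (xi j 0) (xi k 0) => a b [a' b'] /=; ring.
  rewrite (big_morph _ ImD (erefl _)).
  under eq_bigr do rewrite (big_morph _ ImD (erefl _)).
  set S := LHS; have : S = - S.
    rewrite {2}/S exchange_big -sumrN /=; apply: eq_bigr => j _.
    by rewrite -sumrN; apply: eq_bigr => k _; exact: FN.
  by move=> SN; lra.
by rewrite lecR divr_ge0// addr_ge0.
Qed.

End LeviForm.

(** * Comparison *)

Section Comparison.
Variables (R : realType) (m : nat).

Lemma closure_bounded_compact (O : set 'rV[R]_m) : bounded_set O -> compact (closure O).
Proof.
move=> bO; apply: bounded_closed_compact; last exact: closed_closure.
have [M [Mr OM]] := bO; exists M; split => // N MN x.
have cN : closed [set y : 'rV[R]_m | `|y| <= N].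
  have := @preimage_closed _ _ _ [set r : R | r <= N] (fun z _ => @norm_continuous _ _ z).
  by apply; exact: closed_le.
by move=> /(closureS (OM _ MN)); rewrite closure_id in cN; rewrite -cN.
Qed.

Lemma near_sq_ball (x : 'rV[R]_m) s : 0 < s ->
  \forall y \near x, dot (y - x) (y - x) < s.
Proof.
by move=> s0; have /cvgr_lt := @continuous_sq R m x x; apply; rewrite subrr dot0l.
Qed.

Lemma near_sqP (x : 'rV[R]_m) (P : 'rV[R]_m -> Prop) :
  (\forall y \near x, P y) -> exists2 s, 0 < s & forall y, dot (y - x) (y - x) < s -> P y.
Proof.
move=> /near_translate/near0_sqP[s s0 sP]; exists s => // y /sP.
by rewrite addrC subrK.
Qed.

Lemma near_center (x : 'rV[R]_m) (P : 'rV[R]_m -> Prop) :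
  (\forall d \near (0 : 'rV[R]_m), P d) -> \forall y \near x, P (y - x).
Proof. by move=> /near0_sqP[s /(near_sq_ball x) + sP]; apply: filterS => y; exact: sP. Qed.

Lemma continuous_within_open (O : set 'rV[R]_m) (g : 'rV[R]_m -> R -> R) x r e :
  open O -> {within O `*` setT, continuous (fun p : 'rV[R]_m * R => g p.1 p.2)} ->
  O x -> 0 < e -> exists2 s, 0 < s & forall y r', dot (y - x) (y - x) < s ->
    `|r' - r| < s -> `|g y r' - g x r| < e.
Proof.
move=> oO cg Ox e0.
have oOT : open (O `*` [set: R]).
  rewrite openE => -[y r'] [/= Oy _]; exists (O, setT) => //.
  by split; [exact: open_nbhs_nbhs|exact: filterT].
rewrite continuous_open_subspace// in cg.
have /cvgrPdist_lt/(_ e e0) := cg (x, r) (mem_set (conj Ox I)).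
move=> [[A B] /= [/near_sqP[s s0 sA] /nbhs_ballP[s' /= s'0 sB]] ABe].
exists (Num.min s s'); first by rewrite lt_min s0.
move=> y r'; rewrite !lt_min => /andP[ys _] /andP[_ rs].
rewrite distrC; apply: (ABe (y, r')); split => /=; first exact: sA.
by apply: sB; rewrite /ball /= distrC.
Qed.

(** By compactness it suffices to argue near each [x0]. If [u x0 - v x0 < M], semicontinuity
    excludes near-maximal pairs; otherwise the boundary inequality puts [x0] in [O], and strict
    monotonicity separates [g x0 (v x0)] from [g x0 (u x0)]. *)
Lemma comparison_gap (O : set 'rV[R]_m) (g : 'rV[R]_m -> R -> R) (u v : 'rV[R]_m -> R) M :
  open O -> compact (closure O) ->
  {within O `*` setT, continuous (fun p : 'rV[R]_m * R => g p.1 p.2)} ->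
  (forall z, O z -> forall s t : R, s < t -> g z s < g z t) ->
  usc_on (closure O) u -> lsc_on (closure O) v ->
  (forall z, (closure O `\` O) z -> u z <= v z) ->
  0 < M -> (forall z, closure O z -> u z - v z <= M) ->
  exists2 rho, 0 < rho & forall x y, closure O x -> closure O y ->
    dot (x - y) (x - y) < rho -> M - rho < u x - v y ->
    [/\ O x, O y & g y (v y) + rho < g x (u x)].
Proof.
move=> oO cK cg gincr uu lv uv M0 uvM; set K := closure O.
pose P rho x := forall y, K y -> dot (x - y) (x - y) < rho -> M - rho < u x - v y ->
    [/\ O x, O y & g y (v y) + rho < g x (u x)].
suff : \forall rho \near (0 : R)^'+, K `<=` P rho /\ 0 < rho.
  move=> /(@filter_ex _ _ (at_right_proper_filter (0 : R)))[rho [KP rho0]].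
  by exists rho => // x y Kx; exact: KP.
apply: filterI; last exact: nbhs_right_gt.
move/compact_near_coveringP/near_covering_withinP in cK.
apply: (cK R (0 : R)^'+ P) => x0 Kx0.
have [e [s [r0 [e0 s0 r00 H]]]] : exists e s r0, [/\ 0 < e, 0 < s, 0 < r0 &
    forall x y rho, dot (x - x0) (x - x0) < s -> dot (y - x0) (y - x0) < s ->
      u x < u x0 + e -> v x0 - e < v y -> rho < r0 -> M - rho < u x - v y ->
      [/\ O x, O y & g y (v y) + rho < g x (u x)]].
  have [gap|nogap] := ltP (u x0 - v x0) M.
    pose D := M - (u x0 - v x0); exists (D / 4), 1, (D / 2).
    have D0 : 0 < D by rewrite subr_gt0.
    by split=> [|||x y rho _ _]; rewrite ?divr_gt0// /D; lra.
  have Ox0 : O x0.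
    by apply: contrapT => nOx0; have := uv x0 (conj Kx0 nOx0); lra.
  pose c := (g x0 (u x0) - g x0 (v x0)) / 4.
  have c0 : 0 < c by rewrite divr_gt0// subr_gt0 gincr//; lra.
  have [s1 s10 gu] := continuous_within_open (u x0) oO cg Ox0 c0.
  have [s2 s20 gv] := continuous_within_open (v x0) oO cg Ox0 c0.
  have [s3 s30 sO] := near_sqP (open_nbhs_nbhs (conj oO Ox0)).
  pose e := Num.min s1 s2 / 2.
  have [e0 es1 es2] : [/\ 0 < e, 2 * e <= s1 & 2 * e <= s2].
    rewrite mulrC divfK// divr_gt0// ?lt_min ?s10//.
    by rewrite !ge_min !lexx orbT.
  exists e, (Num.min s1 (Num.min s2 s3)), (Num.min e c).
  split=> [//|||x y rho]; rewrite ?lt_min ?s10 ?s20 ?e0//.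
  move=> /and3P[xs1 _ xs3] /and3P[_ ys2 ys3] ux vy /andP[rhoe rhoc] uxvy.
  split; [exact: sO|exact: sO|].
  have uvM0 := uvM _ Kx0.
  (* Semicontinuity bounds [u x] and [- v y] only from above; near-maximality of [u x - v y]
     supplies the bounds from below. *)
  have ux1 : `|u x - u x0| < s1 by rewrite ltr_norml; apply/andP; split; lra.
  have vy1 : `|v y - v x0| < s2 by rewrite ltr_norml; apply/andP; split; lra.
  have := gu _ _ xs1 ux1; have := gv _ _ ys2 vy1.
  by rewrite !ltr_norml => /andP[_ g1] /andP[g2 _]; rewrite /c in c0 rhoc g1 g2; lra.
have [t t0 tK] : exists2 t, 0 < t & forall x, dot (x - x0) (x - x0) < t ->
    K x -> u x < u x0 + e /\ v x0 - e < v x.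
  apply: near_sqP; apply: filterS2 (uu x0 Kx0 e e0) (lv x0 Kx0 e e0).
  by move=> x ux vx Kx; split; [exact: ux|exact: vx].
pose w := Num.min s t; have w0 : 0 < w by rewrite lt_min s0.
exists ([set x | dot (x - x0) (x - x0) < w / 4],
        [set rho | rho < Num.min r0 (w / 4)]) => /=.
  split; first by apply: near_sq_ball; rewrite divr_gt0.
  by apply: nbhs_right_lt; rewrite lt_min r00 divr_gt0.
move=> [x rho] /= [xw]; rewrite lt_min => /andP[rhor rhow] Kx y Ky xy uxvy.
have yw : dot (y - x0) (y - x0) < w.
  rewrite (_ : y - x0 = (x - x0) - (x - y)); last first.
    by apply/rowP => i; rewrite !mxE; ring.
  by apply: le_lt_trans (sqD_le _ _) _; rewrite dotNl dotNr opprK; lra.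
have {}xw : dot (x - x0) (x - x0) < w by lra.
move: xw yw; rewrite !lt_min => /andP[xs xt] /andP[ys yt].
by have [ux _] := tK x xt Kx; have [_ vy] := tK y yt Ky; exact: H.
Qed.

End Comparison.

Lemma le_from_signs (R : realDomainType) (a b c d : R) :
  a <= b -> b + c <= 0 -> 0 <= a + d -> c <= d.
Proof. lra. Qed.

Theorem theorem3p13 (R : realType) (n : nat)
  (O : set 'rV[R]_(n + n))
  (G : 'M[R[i]]_n -> R) (g : 'rV[R]_(n + n) -> R -> R)
  (h : 'rV[R]_(n + n) -> R) (u v : 'rV[R]_(n + n) -> R) :
  bounded_domain O ->
  continuous_on_cone G ->
  degenerate_elliptic G ->
  {within O `*` setT, continuous (fun p : 'rV[R]_(n + n) * R => g p.1 p.2)} ->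
  (forall z, O z -> forall s t : R, s < t -> g z s < g z t) ->
  continuous h ->
  usc_on (closure O) u ->
  lsc_on (closure O) v ->
  visc_sub O G g h u ->
  visc_super O G g h v ->
  (forall z, (closure O `\` O) z -> u z <= v z) ->
  forall z, O z -> u z <= v z.
Proof.
move=> [oO _ _ bO] _ Gell cg gincr ch uu lv usub vsup uv z0 Oz0.
rewrite leNgt; apply/negP => vu0.
have cK := closure_bounded_compact bO.
have K0 : closure O z0 by exact: subset_closure.
have uw : usc_on (closure O) (fun z => u z + - v z).
  apply: uscD uu _ => z Kz e e0; apply: filterS (lv z Kz e e0) => y vy Ky.
  by have := vy Ky; lra.
have [zM KzM wM] := usc_max cK (ex_intro _ _ K0) uw.
have M0 : 0 < u zM - v zM by have := wM _ K0; lra.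
have [rho rho0 gap] := comparison_gap oO cK cg gincr uu lv uv M0 wM.
have [x [y [p [q [X [Y [[Kx Ky xy uxvy] hpq jetu jetv XY]]]]]]] :=
  theorem_on_sums cK uu lv ch KzM rho0.
have [Ox Oy guv] := gap x y Kx Ky xy uxvy.
have inO z : O z -> \forall y \near z, closure O y.
  move=> Oz; apply: filterS (open_nbhs_nbhs (conj oO Oz)); exact: subset_closure.
have [pos1 sub1] : semipos (cHess (quadratic (u x) x p X) x) /\
    G (cHess (quadratic (u x) x p X) x) + expR (g x (u x) + h p) <= 0.
  have := usub x Ox (quadratic (u x) x p X); rewrite grad_quadratic; apply.
  - exact: C2_near_quadratic.
  - exact: quadratic_center.
  apply: filterS2 (inO x Ox) (@near_center _ _ x _ jetu) => z Kz.
  by rewrite quadratic_center subrr subr_le0 (addrC x) subrK => /(_ Kz).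
have posE : semipos (cHess (quadratic (v y) y q Y) y - cHess (quadratic (u x) x p X) x).
  rewrite !cHess_quadratic -levi_mxB; apply: semipos_levi_mx => [|d].
    by apply/matrixP => a b; rewrite !mxE; ring.
  have qT (A : 'M[R]_(n + n)) : qform A^T d = qform A d.
    by rewrite /qform dot_mulmx trmxK dotC.
  by rewrite qformDl qformNl !qformDl !qT; have := XY d; lra.
(* The supersolution may be tested only where the complex Hessian is semi-positive; this is
   inherited from the subsolution. *)
have pos2 : semipos (cHess (quadratic (v y) y q Y) y).
  by rewrite -[cHess _ y](subrK (cHess (quadratic (u x) x p X) x)); exact: semiposD.
have sup2 : 0 <= G (cHess (quadratic (v y) y q Y) y) + expR (g y (v y) + h q).
  have := vsup y Oy (quadratic (v y) y q Y); rewrite grad_quadratic; apply=> //.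
  - exact: C2_near_quadratic.
  - exact: quadratic_center.
  apply: filterS2 (inO y Oy) (@near_center _ _ y _ jetv) => z Kz.
  by rewrite quadratic_center subrr subr_ge0 (addrC y) subrK => /(_ Kz).
have GE := Gell _ _ pos1 pos2 posE.
(* Ellipticity eliminates [G] and leaves [g x (u x) + h p <= g y (v y) + h q], contradicting [guv]
   because [h p] and [h q] differ by less than [rho]. *)
have := le_from_signs GE sub1 sup2.
by clear - hpq guv; rewrite ler_expR; move: hpq; rewrite ltr_norml => /andP[]; lra.
Qed.
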